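(* Let $H_1, H_2$ be graphs. There exists a constant $c \in \mathbb{N}$ such that the class of $\{H_1, H_2\}$-free graphs is $c$-apex-perfect if and only if, up to switching the labels of $H_1$ and $H_2$ and up to taking complements of both (that is, after possibly interchanging $H_1$ and $H_2$, and possibly replacing the pair $(H_1,H_2)$ by $(\overline{H_1},\overline{H_2})$), one of the following holds: 1. $H_1$ is an induced subgraph of $P_4$; 2. $H_1$ is an induced subgraph of $\overline{P_3+K_1}$ and $H_2$ is an induced subgraph of $P_3+rK_1$ for some $r \in \mathbb{N}$; 3. $H_1$ is a complete graph and $H_2$ is edgeless; 4. $H_1$ is an induced subgraph of $\overline{K_2 + 2K_1}$ and $H_2$ is an induced subgraph of $K_2 + 2K_1$; or 5. $H_1 \cong C_4$ and $H_2 \cong 2K_2$, in which case one can take $c = 1$.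
   Context: All graphs are finite and simple. $\overline{G}$ denotes the complement of $G$. $G+H$ denotes the disjoint union of $G$ and $H$; for a non-negative integer $r$, $rH$ is the disjoint union of $r$ copies of $H$. $K_r$, $C_r$, $P_r$ denote the complete graph, cycle and path on $r$ vertices. ''Induced subgraph of $X$'' means isomorphic to $X[S]$ for some $S\subseteq V(X)$. A graph $G$ contains $H$ if some induced subgraph of $G$ is isomorphic to $H$; for a set $\mathcal{H}$ of graphs, $G$ is $\mathcal{H}$-free if it contains no graph in $\mathcal{H}$. A graph $G$ is perfect if $\omega(H)=\chi(H)$ for every induced subgraph $H$ of $G$. A graph $G$ is $c$-apex-perfect if there is $S\subseteq V(G)$ with $|S|\le c$ such that $G-S$ is perfect; a class of graphs is $c$-apex-perfect if every graph in it is. *)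

(* Defs.v *)
From mathcomp Require Import all_boot.

Set Implicit Arguments.
Unset Strict Implicit.
Unset Printing Implicit Defensive.

Record sgraph := SGraph {
  vertex :> finType;
  adj : rel vertex;
  adj_sym : symmetric adj;
  adj_irr : irreflexive adj }.

Definition iso (G H : sgraph) : Prop :=
  exists2 f : G -> H, bijective f & forall x y, adj (f x) (f y) = adj x y.

Section Constructions.
Variables (G H : sgraph) (S : {set G}) (r : nat).

Definition induced_adj : rel {x : G | x \in S} :=
  fun x y => adj (val x) (val y).
Lemma induced_sym : symmetric induced_adj.
Proof. by move=> x y; apply: adj_sym. Qed.
Lemma induced_irr : irreflexive induced_adj.
Proof. by move=> x; apply: adj_irr. Qed.
Definition induced : sgraph := SGraph induced_sym induced_irr.

Definition compl_adj : rel G := fun x y => (x != y) && ~~ adj x y.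
Lemma compl_sym : symmetric compl_adj.
Proof. by move=> x y; rewrite /compl_adj eq_sym adj_sym. Qed.
Lemma compl_irr : irreflexive compl_adj.
Proof. by move=> x; rewrite /compl_adj eqxx. Qed.
Definition compl : sgraph := SGraph compl_sym compl_irr.

Definition disjoint_union_adj : rel (G + H)%type := fun u v =>
  match u, v with
  | inl x, inl y => adj x y
  | inr x, inr y => adj x y
  | _, _ => false
  end.
Lemma disjoint_union_sym : symmetric disjoint_union_adj.
Proof. by move=> [x|x] [y|y] //=; apply: adj_sym. Qed.
Lemma disjoint_union_irr : irreflexive disjoint_union_adj.
Proof. by move=> [x|x] /=; apply: adj_irr. Qed.
Definition disjoint_union : sgraph :=
  SGraph disjoint_union_sym disjoint_union_irr.

Definition copies_adj : rel ('I_r * G)%type :=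
  fun u v => (u.1 == v.1) && adj u.2 v.2.
Lemma copies_sym : symmetric copies_adj.
Proof. by move=> u v; rewrite /copies_adj eq_sym adj_sym. Qed.
Lemma copies_irr : irreflexive copies_adj.
Proof. by move=> u; rewrite /copies_adj adj_irr andbF. Qed.
Definition copies : sgraph := SGraph copies_sym copies_irr.

Definition complete_adj : rel 'I_r := fun i j => i != j.
Lemma complete_sym : symmetric complete_adj.
Proof. by move=> i j; rewrite /complete_adj eq_sym. Qed.
Lemma complete_irr : irreflexive complete_adj.
Proof. by move=> i; rewrite /complete_adj eqxx. Qed.
Definition complete : sgraph := SGraph complete_sym complete_irr.

Definition path_adj : rel 'I_r :=
  fun i j => (i.+1 == j :> nat) || (j.+1 == i :> nat).
Lemma path_sym : symmetric path_adj.
Proof. by move=> i j; rewrite /path_adj orbC. Qed.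
Lemma path_irr : irreflexive path_adj.
Proof. by move=> i; rewrite /path_adj orbb gtn_eqF. Qed.
Definition path_graph : sgraph := SGraph path_sym path_irr.

(* [i != j] only matters for r = 1, where it rules out a loop; this is the
   cycle on r vertices when r >= 3. *)
Definition cycle_adj : rel 'I_r :=
  fun i j => (i != j) && ((i.+1 %% r == j) || (j.+1 %% r == i)).
Lemma cycle_sym : symmetric cycle_adj.
Proof. by move=> i j; rewrite /cycle_adj eq_sym orbC. Qed.
Lemma cycle_irr : irreflexive cycle_adj.
Proof. by move=> i; rewrite /cycle_adj eqxx. Qed.
Definition cycle_graph : sgraph := SGraph cycle_sym cycle_irr.

End Constructions.

Definition induced_subgraph (H G : sgraph) : Prop :=
  exists S : {set G}, iso H (induced S).

Definition is_complete (G : sgraph) : Prop := forall x y : G, x != y -> adj x y.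

Definition is_edgeless (G : sgraph) : Prop := forall x y : G, ~~ adj x y.

Definition clique (G : sgraph) (S : {set G}) : bool :=
  [forall x in S, forall y in S, (x != y) ==> adj x y].

Definition omega (G : sgraph) : nat := \max_(S : {set G} | clique S) #|S|.

Definition colorable (G : sgraph) (k : nat) : bool :=
  [exists f : {ffun G -> 'I_k}, forall x, forall y, adj x y ==> (f x != f y)].

Lemma ex_colorable (G : sgraph) : exists k, colorable G k.
Proof.
exists #|G|; apply/existsP; exists [ffun x => enum_rank x].
apply/forallP=> x; apply/forallP=> y; apply/implyP=> xy.
rewrite !ffunE (inj_eq enum_rank_inj); apply: contraTneq xy => ->.
by rewrite adj_irr.
Qed.

Definition chi (G : sgraph) : nat := ex_minn (ex_colorable G).

Definition perfect (G : sgraph) : Prop :=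
  forall H : sgraph, induced_subgraph H G -> omega H = chi H.

Definition apex_perfect (c : nat) (G : sgraph) : Prop :=
  exists2 S : {set G}, #|S| <= c & perfect (induced (~: S)).

Definition apex_perfect_class (c : nat) (C : sgraph -> Prop) : Prop :=
  forall G : sgraph, C G -> apex_perfect c G.

Definition free (HH : sgraph -> Prop) (G : sgraph) : Prop :=
  forall H : sgraph, HH H -> ~ induced_subgraph H G.

Definition pair_set (H1 H2 : sgraph) : sgraph -> Prop :=
  fun H => H = H1 \/ H = H2.

Definition up_to_switch_compl (P : sgraph -> sgraph -> Prop)
    (H1 H2 : sgraph) : Prop :=
  [\/ P H1 H2, P H2 H1, P (compl H1) (compl H2) | P (compl H2) (compl H1)].

(* Main.v *)
Require Import Defs.
From mathcomp Require Import all_boot.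
From mathcomp Require Import ssralg ssrnum rat matrix.

(** Why the classification holds.

    Sufficiency.  Each pair in the list has its own reason.  A P4-free graph is
    perfect because in it every maximal stable set meets every maximum clique.
    Excluding a complete and an edgeless graph bounds the number of vertices
    (Ramsey).  In a paw-free graph the vertices lying in triangles form a union
    of components inducing a P4-free graph; the rest is triangle-free, and
    excluding P3 + rK1 makes it bipartite up to boundedly many vertices
    ([near_bipartite]).  A graph without diamond and co-diamond that has a clique
    of size 4 is covered by two cliques ([perfect_on_big_clique]), hence perfect;
    if neither it nor its complement has such a clique, it has bounded size.  A
    graph without C4 and 2K2 is split or contains a C5, and then becomes split
    after deleting any vertex of the C5 ([split_or_C5]).  The pairs obtained by
    complementation need no separate treatment, since complements of perfect
    graphs are perfect; this is derived from the characterization of perfection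
    by |B| <= omega(B) alpha(B) for all sets B of vertices
    ([perfect_on_count]), which is visibly symmetric.

    Necessity.  A graph containing m disjoint induced copies of C5 or C7 does not
    become perfect after deleting fewer than m vertices, so it must contain H1
    or H2.  Three families with this property suffice, each obtained from m
    disjoint odd cycles by a rule for the adjacencies between different cycles
    ([blocks]):
      - disjoint C7's, containing no C3, C4, C5 and no vertex of degree 3;
      - the blow-up of C5 by stable sets of size m, containing no triangle, no
        2K2 and no P4 + K1;
      - three cliques joined by partial matchings, containing no diamond and no
        4K1.
    Applied to the pair and to the pair of complements, the first family shows
    that, unless H1 or H2 embeds in P4, one of H1, H2 and the complement of the
    other embed in disjoint C7's.  Such a graph is 2K2 or has three independent
    vertices ([heptagons_alpha]).  The blow-up then leaves only the case of two
    2K2's or forces both graphs into some P3 + rK1 ([blowup_short_path]), and the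
    third family rules out the remaining bad combinations
    ([no_codiamond_stable4]). *)

Set Implicit Arguments.
Unset Strict Implicit.
Unset Printing Implicit Defensive.

(** * Induced subgraphs as embeddings *)

Definition embeds (H G : sgraph) : bool :=
  [exists f : {ffun H -> G},
    injectiveb f && [forall x, forall y, adj (f x) (f y) == adj x y]].

Lemma embedsP (H G : sgraph) :
  reflect (exists2 f : H -> G, injective f & forall x y, adj (f x) (f y) = adj x y)
          (embeds H G).
Proof.
apply: (iffP existsP) => [[f /andP[/injectiveP fI /forallP fE]]|[f fI fE]].
  by exists f => // x y; apply/eqP/(forallP (fE x)).
exists [ffun x => f x]; apply/andP; split.
  by apply/injectiveP => x y; rewrite !ffunE => /fI.
by apply/forallP => x; apply/forallP => y; rewrite !ffunE fE.
Qed.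

Lemma induced_subgraphP (H G : sgraph) : induced_subgraph H G <-> embeds H G.
Proof.
split=> [[S [f fB fE]]|/embedsP[f fI fE]].
  apply/embedsP; exists (val \o f) => [x y /val_inj /(bij_inj fB) //|x y].
  by rewrite /= -fE.
have fS x : f x \in [set f y | y in H] by apply: imset_f.
exists [set f y | y in H], (fun x => exist _ (f x) (fS x) : induced _) => [|//].
apply: inj_card_bij => [x y /(congr1 val) /fI //|].
by rewrite /= card_sig (eq_card (B := [set f y | y in H])) ?card_imset.
Qed.

Lemma embeds_trans G H K : embeds G H -> embeds H K -> embeds G K.
Proof.
move=> /embedsP[f fI fE] /embedsP[g gI gE]; apply/embedsP.
by exists (g \o f) => [|x y]; [apply: inj_comp | rewrite /= gE fE].
Qed.

Lemma embeds_compl H G : embeds H G -> embeds (compl H) (compl G).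
Proof.
move=> /embedsP[f fI fE]; apply/embedsP; exists f => //= x y.
by rewrite /compl_adj fE (inj_eq fI).
Qed.

Lemma adj_complK (G : sgraph) (x y : G) :
  @adj (compl (compl G)) x y = @adj G x y.
Proof. by rewrite /= /compl_adj /= /compl_adj; case: eqVneq => [->|_];
  rewrite ?adj_irr //= negbK. Qed.

Lemma embeds_complL H G : embeds (compl H) G = embeds H (compl G).
Proof.
apply/idP/idP => /embeds_compl /embedsP[f fI fE]; apply/embedsP; exists f => // x y.
  by rewrite fE adj_complK.
by rewrite -adj_complK fE.
Qed.

Lemma embeds_complK H G : embeds (compl H) (compl G) = embeds H G.
Proof.
apply/idP/idP => [|/embeds_compl//]; rewrite embeds_complL.
by case/embedsP => f fI fE; apply/embedsP; exists f => // x y; rewrite -fE adj_complK.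
Qed.

Lemma iso_embeds H G : iso H G -> embeds H G.
Proof. by case=> f /bij_inj fI fE; apply/embedsP; exists f. Qed.

Lemma iso_sym H G : iso H G -> iso G H.
Proof.
case=> f [g fK gK] fE; exists g; first by exists f.
by move=> x y; rewrite -fE !gK.
Qed.

Lemma embeds_card_iso H G : embeds H G -> #|G| <= #|H| -> iso H G.
Proof. by case/embedsP => f fI fE cGH; exists f => //; apply: inj_card_bij. Qed.

(** The entries of the adjacency matrix of [s] above the diagonal, row by row.
    A graph on four given vertices becomes a list of six booleans, so that
    recognizing a small induced subgraph is an equality of bit lists.
*)
Fixpoint adj_code (T : Type) (e : rel T) (s : seq T) : seq bool :=
  if s is x :: s' then [seq e x y | y <- s'] ++ adj_code e s' else [::].

Lemma adj_code_nth (T T' : Type) (e : rel T) (e' : rel T') x0 y0 s t :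
  size s = size t -> adj_code e s = adj_code e' t ->
  forall i j, i < j < size s ->
  e (nth x0 s i) (nth x0 s j) = e' (nth y0 t i) (nth y0 t j).
Proof.
elim: s t => [|x s IH] [|y t] //=; first by move=> _ _ i j; rewrite ltn0 andbF.
move=> [] sz /eqP.
rewrite eqseq_cat ?size_map // => /andP[/eqP exy /eqP tst] [|i] [|j] //.
  rewrite ltnS /= => ltj; have ltj' := ltj; rewrite sz in ltj'.
  by rewrite -(nth_map x0 false (e x)) // -(nth_map y0 false (e' y)) // exy.
by rewrite !ltnS; apply: IH.
Qed.

Lemma embeds_seq (X Y : sgraph) (s : seq X) (t : seq Y) :
  uniq s -> (forall x, x \in s) -> uniq t -> size s = size t ->
  adj_code (@adj X) s = adj_code (@adj Y) t -> embeds X Y.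
Proof.
move=> us sP ut sz st; apply/embedsP.
case: t ut sz st => [|y0 t'].
  move=> _ /size0nil s0 _.
  have X0 (x : X) : False by have := sP x; rewrite s0.
  by exists (fun x => False_rect _ (X0 x)) => x; case: (X0 x).
set t := y0 :: t' => ut sz st.
have lt x : index x s < size s by rewrite index_mem.
have E x y : x != y -> index x s < index y s ->
    adj (nth y0 t (index x s)) (nth y0 t (index y s)) = adj x y.
  by move=> _ ltxy; rewrite -(adj_code_nth x y0 sz st) ?ltxy ?lt // !nth_index.
exists (fun x => nth y0 t (index x s)) => [x y /eqP|x y].
  rewrite nth_uniq // -?sz // => /eqP xy.
  by rewrite -(nth_index x (sP x)) xy nth_index.
case: (eqVneq x y) => [->|xy]; first by rewrite !adj_irr.
have: index x s != index y s.
  by apply: contraNneq xy => e; rewrite -(nth_index x (sP x)) e nth_index.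
rewrite neq_ltn => /orP[] lxy; first exact: E.
by rewrite adj_sym [RHS]adj_sym; apply: E; rewrite // eq_sym.
Qed.

(** * Perfection relative to a set of vertices *)

Lemma cliqueP (G : sgraph) (K : {set G}) :
  reflect {in K &, forall x y, x != y -> adj x y} (clique K).
Proof.
apply: (iffP forall_inP) => [H x y xK yK xy|H x xK].
  exact: (implyP (forall_inP (H x xK) y yK)).
by apply/forall_inP => y yK; apply/implyP; apply: H.
Qed.

Lemma clique_sub (G : sgraph) (K L : {set G}) : K \subset L -> clique L -> clique K.
Proof.
by move=> /subsetP KL /cliqueP cL; apply/cliqueP => x y /KL xL /KL yL; apply: cL.
Qed.

Lemma clique_complP (G : sgraph) (K : {set G}) :
  reflect {in K &, forall x y, ~~ adj x y} (@clique (compl G) K).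
Proof.
apply: (iffP (@cliqueP (compl G) K)) => H x y xK yK; last first.
  by move=> xy; rewrite /= /compl_adj xy H.
case: (eqVneq x y) => [->|xy]; first by rewrite adj_irr.
by have /andP[] := H x y xK yK xy.
Qed.

(** Clique number, colourability and perfection of induced subgraphs are
    expressed for subsets of one fixed vertex type: the inductions below remove
    vertices and pass to the complement, and no vertex type changes then.
    Stable sets are the cliques of the complement. *)
Definition omega_on (G : sgraph) (A : {set G}) : nat :=
  \max_(K : {set G} | (K \subset A) && clique K) #|K|.
Arguments omega_on G A : clear implicits.

Definition colorable_on (G : sgraph) (A : {set G}) (k : nat) : bool :=
  colorable (induced A) k.
Arguments colorable_on G A k : clear implicits.

Definition perfect_on (G : sgraph) (A : {set G}) : Prop :=
  forall B : {set G}, B \subset A -> colorable_on G B (omega_on G B).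
Arguments perfect_on G A : clear implicits.

Section Perf.
Variable G : sgraph.
Implicit Types A B K : {set G}.

Lemma omega_on_ge A K : K \subset A -> clique K -> #|K| <= omega_on G A.
Proof. by move=> KA cK; apply: (bigmax_sup K); rewrite ?KA. Qed.

Lemma omega_on_ex A : exists K, [/\ K \subset A, clique K & #|K| = omega_on G A].
Proof.
have P0 : (set0 \subset A) && clique (set0 : {set G}).
  by rewrite sub0set; apply/cliqueP => x y; rewrite inE.
have [|K /andP[KA cK] e] := @eq_bigmax_cond _ [pred K : {set G} | (K \subset A) && clique
  K] (fun K => #|K|).
  by apply/card_gt0P; exists set0.
by exists K; split=> //; rewrite /omega_on e.
Qed.

Lemma omega_on_mono A B : A \subset B -> omega_on G A <= omega_on G B.
Proof.
move=> AB; have [K [KA cK <-]] := omega_on_ex A.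
by apply: omega_on_ge => //; apply: subset_trans AB.
Qed.

Lemma omega_on_gt0 A x : x \in A -> 0 < omega_on G A.
Proof.
move=> xA; rewrite -(cards1 x); apply: omega_on_ge; first by rewrite sub1set.
by apply/cliqueP => y z; rewrite !inE => /eqP-> /eqP->; rewrite eqxx.
Qed.

Lemma omega_on_gt1 A x y : x \in A -> y \in A -> adj x y -> 1 < omega_on G A.
Proof.
move=> xA yA xy.
have nxy : x != y by apply: contraTneq xy => ->; rewrite adj_irr.
have <- : #|[set x; y]| = 2 by rewrite cards2 nxy.
apply: omega_on_ge; first by rewrite subUset !sub1set xA.
by apply/cliqueP => u v; rewrite !inE => /orP[]/eqP-> /orP[]/eqP->;
  rewrite ?eqxx // adj_sym.
Qed.

Lemma colorable_onP A k :
  reflect (exists2 f : G -> nat, {in A, forall x, f x < k} &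
             {in A &, forall x y, adj x y -> f x != f y})
          (colorable_on G A k).
Proof.
apply: (iffP existsP) => [[f /forallP fP]|[f fk fP]].
  exists (fun x => if insub x is Some u then val (f u) else 0).
    by move=> x xA; rewrite insubT /=.
  move=> x y xA yA xy; rewrite !insubT /=.
  have /forallP/(_ (exist _ y yA))/implyP/(_ xy) := fP (exist _ x xA).
  by apply: contraNneq => e; apply/eqP/val_inj.
exists [ffun u : induced A => Ordinal (fk _ (valP u))].
apply/forallP => u; apply/forallP => v; apply/implyP => uv; rewrite !ffunE.
by apply: contraNneq (fP _ _ (valP u) (valP v) uv) => - [->].
Qed.

Lemma colorable_on_mono A B k l : A \subset B -> k <= l -> colorable_on G B k ->
  colorable_on G A l.
Proof.
move=> /subsetP AB kl /colorable_onP[f fk fP]; apply/colorable_onP; exists f.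
  by move=> x /AB /fk xk; apply: leq_trans kl.
by move=> x y /AB xB /AB yB; apply: fP.
Qed.

End Perf.

Lemma omega_le_colorable (H : sgraph) k : colorable H k -> omega H <= k.
Proof.
case/existsP=> f /forallP fP; apply/bigmax_leqP => S /cliqueP cS.
rewrite -[k]card_ord -(card_in_imset (f := f)) ?max_card // => x y xS yS.
move/eqP; apply: contraTeq => xy.
by apply: (implyP (forallP (fP x) y)); apply: cS.
Qed.

(** The clique number is always a lower bound for the chromatic number, so only
    the existence of a colouring is at stake. *)
Lemma omega_chi (H : sgraph) : omega H = chi H <-> colorable H (omega H).
Proof.
rewrite /chi; case: ex_minnP => m cm minm; split=> [-> //|co].
by apply/eqP; rewrite eqn_leq omega_le_colorable //= minm.
Qed.

Section Embedding.
Variables (H G : sgraph) (f : H -> G).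
Hypotheses (fI : injective f) (fE : forall x y, adj (f x) (f y) = adj x y).

Lemma omega_image : omega H = omega_on G [set f x | x in H].
Proof.
apply/eqP; rewrite eqn_leq; apply/andP; split.
  apply/bigmax_leqP => S /cliqueP cS; rewrite -(card_imset S fI); apply: omega_on_ge.
    by apply/subsetP => _ /imsetP[x _ ->]; apply: imset_f.
  apply/cliqueP => _ _ /imsetP[x xS ->] /imsetP[y yS ->].
  by rewrite (inj_eq fI) fE; apply: cS.
have [K [/subsetP Kf /cliqueP cK <-]] := omega_on_ex [set f x | x in H].
have -> : K = f @: (f @^-1: K).
  apply/setP => y; apply/idP/imsetP => [yK|[x xK ->]]; last by rewrite inE in xK.
  by have /imsetP[x _ yE] := Kf y yK; exists x; rewrite // inE -yE.
rewrite card_imset //; apply: (bigmax_sup (f @^-1: K)) => //.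
apply/cliqueP => x y; rewrite !inE => xK yK xy; rewrite -fE.
by apply: cK; rewrite ?(inj_eq fI).
Qed.

Lemma colorable_image k : colorable_on G [set f x | x in H] k -> colorable H k.
Proof.
case/colorable_onP=> g gk gP.
have fS x : f x \in [set f x | x in H] by apply: imset_f.
apply/existsP; exists [ffun x => Ordinal (gk _ (fS x))].
apply/forallP => u; apply/forallP => v; apply/implyP => uv; rewrite !ffunE.
by apply: contraNneq (gP _ _ (fS u) (fS v) _) => [[->]|]; rewrite ?fE.
Qed.

End Embedding.

Lemma perfect_inducedP (G : sgraph) (A : {set G}) : perfect (induced A) <-> perfect_on G A.
Proof.
have vE (B : {set G}) : [set val x | x in induced B] = B.
  apply/setP => x; apply/imsetP/idP => [[u _ ->]|xB]; first exact: valP u.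
  by exists (exist _ x xB).
split=> [pA B /subsetP BA|pA H].
  have emb : embeds (induced B) (induced A).
    apply/embedsP; exists (fun u => exist _ (val u) (BA _ (valP u)) : induced A) => //.
    by move=> u v e; apply: val_inj; apply: (congr1 val e).
  have /omega_chi := pA _ (proj2 (induced_subgraphP _ _) emb).
  have -> // : omega (induced B) = omega_on G B.
  by rewrite (@omega_image (induced B) G val) ?vE // => u v /val_inj.
move/induced_subgraphP/embedsP => [g gI gE]; apply/omega_chi.
have fI : injective (val \o g) by move=> x y /val_inj /gI.
have fE x y : @adj G ((val \o g) x) ((val \o g) y) = adj x y by rewrite -gE.
rewrite (omega_image fI fE); apply: (colorable_image fE); apply: pA.
by apply/subsetP => _ /imsetP[x _ ->]; apply: valP (g x).
Qed.

Lemma apex_perfectP (c : nat) (G : sgraph) :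
  apex_perfect c G <-> exists2 S : {set G}, #|S| <= c & perfect_on G (~: S).
Proof. by split=> [] [S Sc /perfect_inducedP pS]; exists S. Qed.

(** * Perfection is preserved by complementation *)

Section Fisher.
Import GRing.Theory Num.Theory.
Local Open Scope ring_scope.

(** The incidence matrices of the families [S] and [K] have product J - I, with
    J the all-one matrix, which is invertible once its size n exceeds 1: its
    inverse is J / (n - 1) - I.  Hence the inner dimension is at least n. *)
Lemma card_le_of_cross_intersections (J T : finType) (A : {set T}) (S K : J -> {set T}) :
  (1 < #|J|)%N -> (forall t, K t \subset A) ->
  (forall t u, #|S t :&: K u| = (t != u) :> nat) -> (#|J| <= #|A|)%N.
Proof.
move=> J1 KA SK; set n := #|J|.
pose X : 'M[rat]_(n, #|A|) := \matrix_(i, k) (enum_val k \in S (enum_val i))%:R.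
pose Y : 'M[rat]_(#|A|, n) := \matrix_(k, j) (enum_val k \in K (enum_val j))%:R.
pose U : 'M[rat]_n := const_mx 1.
have XY : X *m Y = U - 1%:M.
  apply/matrixP => i j; rewrite !mxE.
  transitivity (#|S (enum_val i) :&: K (enum_val j)|%:R : rat); last first.
    by rewrite SK (inj_eq enum_val_inj); case: eqVneq => _ /=; rewrite ?subrr ?subr0.
  under eq_bigr => k _ do rewrite !mxE -natrM mulnb -in_setI.
  rewrite -(big_enum_val (fun x => (x \in S (enum_val i) :&: K (enum_val j))%:R : rat)) /=.
  rewrite -natr_sum -sum1_card big_mkcond /=; congr _%:R.
  rewrite [RHS]big_mkcond /=; apply: eq_bigr => x _; rewrite in_setI.
  case: (boolP (x \in K _)) => [/(subsetP (KA _)) ->|_]; last by rewrite andbF if_same.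
  by case: ifP; case: (x \in S _).
have UU : U *m U = n%:R *: U.
  apply/matrixP => i j; rewrite !mxE; under eq_bigr => k _ do rewrite !mxE mulr1.
  by rewrite sumr_const card_ord mulr1.
have n0 : n%:R - 1 != 0 :> rat by rewrite subr_eq0 (eqr_nat _ n 1) gtn_eqF.
pose P : 'M[rat]_n := (n%:R - 1)^-1 *: U - 1%:M.
apply: (@mulmx1_min _ _ _ X (Y *m P)); rewrite mulmxA XY /P.
rewrite mulmxBr mulmx1 mulmxBl mul1mx -scalemxAr UU.
have c1 : (n%:R - 1)^-1 * n%:R - (n%:R - 1)^-1 = 1 :> rat.
  by rewrite -[X in _ - X]mulr1 -mulrBr mulVf.
by rewrite scalerA -scalerBl c1 scale1r opprB addrC subrK.
Qed.
End Fisher.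

Section Gasparyan.
Variable G : sgraph.
Implicit Types A B K I : {set G}.

Lemma card_le_colorable_on B k : colorable_on G B k -> #|B| <= k * omega_on (compl G) B.
Proof.
elim: k B => [|k IH] B /colorable_onP[f fk fP].
  rewrite mul0n leqn0 cards_eq0 -subset0; apply/subsetP => x xB.
  by have := fk x xB.
pose B' := [set x in B | f x < k].
have B'B : B' \subset B by apply/subsetP => x; rewrite inE => /andP[].
rewrite mulSn addnC -(cardsID B' B) (setIidPr B'B) leq_add //.
  apply: leq_trans (IH B' _) _; last by rewrite leq_mul2l omega_on_mono ?orbT.
  apply/colorable_onP; exists f => [x|x y]; first by rewrite inE => /andP[].
  by rewrite !inE => /andP[xB _] /andP[yB _]; apply: fP.
apply: omega_on_ge; first exact: subsetDl.
have fE x : x \in B :\: B' -> x \in B /\ f x = k.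
  rewrite !inE => /andP[]; case: (boolP (x \in B)) => //= xB.
  by rewrite -leqNgt => kf _; split=> //; apply/eqP; rewrite eqn_leq kf andbT -ltnS fk.
apply/clique_complP => x y /fE[xB xk] /fE[yB yk].
by apply: contraT => /negbNE /(fP _ _ xB yB); rewrite xk yk eqxx.
Qed.

Lemma stable_clique I K : @clique (compl G) I -> clique K -> #|I :&: K| <= 1.
Proof.
move=> /clique_complP sI /cliqueP cK; apply/card_le1_eqP => x y.
rewrite !inE => /andP[xI xK] /andP[yI yK]; apply/eqP; apply: contraT => xy.
by have := sI x y xI yI; rewrite cK // eq_sym.
Qed.

Lemma colorable_on_setD_stable A I w : @clique (compl G) I ->
  colorable_on G (A :\: I) w -> colorable_on G A w.+1.
Proof.
move=> /clique_complP sI /colorable_onP[f fk fP]; apply/colorable_onP.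
have AI x : x \in A -> x \notin I -> x \in A :\: I by rewrite !inE => -> ->.
exists (fun x => if x \in I then w else f x) => [x xA|x y xA yA xy].
  by case: ifPn => // xI; rewrite ltnW // ltnS fk ?AI.
case: (boolP (x \in I)) => xI; case: (boolP (y \in I)) => yI.
- by have := sI x y xI yI; rewrite xy.
- by rewrite gtn_eqF // fk ?AI.
- by rewrite ltn_eqF // fk ?AI.
- by apply: fP; rewrite ?AI.
Qed.

(** Gasparyan's argument that a minimal imperfect set [A] satisfies
    |A| > omega(A) alpha(A).  Take a maximum stable set I0 and, for each v in I0,
    the colour classes of an omega-colouring of A - v.  Together with I0 these
    are omega alpha + 1 stable sets, and a maximum clique misses exactly one of
    them if it misses any.  Choosing for each of them a maximum clique that
    misses it gives two families to which the matrix bound applies. *)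
Lemma colorable_on_of_count A :
  (forall B, B \proper A -> colorable_on G B (omega_on G B)) ->
  #|A| <= omega_on G A * omega_on (compl G) A -> colorable_on G A (omega_on G A).
Proof.
move=> IH cA; apply: contraT => nA; set w := omega_on G A in nA cA.
have [x0 x0A] : exists x, x \in A.
  apply/set0Pn; apply: contraNneq nA => A0; apply/colorable_onP.
  by exists (fun=> 0) => x; rewrite A0 inE.
have w0 : 0 < w by apply: omega_on_gt0 x0A.
(* If I met all maximum cliques, a colouring of A - I with one colour less
   would extend to A with I as the last colour class. *)
have avoid I : @clique (compl G) I ->
    exists K, [/\ K \subset A, clique K, #|K| = w & I :&: K = set0].
  move=> sI; case: (eqVneq (A :&: I) set0) => [AI0|AI0].
    have [K [KA cK Kw]] := omega_on_ex A; exists K; split=> //.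
    by apply/eqP; rewrite -subset0 -AI0 setIC setSI.
  have pr : A :\: I \proper A.
    rewrite properEneq subsetDl andbT; apply: contraNneq AI0 => /setDidPl.
    by rewrite setI_eq0.
  have [K [KA cK Kw]] := omega_on_ex (A :\: I).
  exists K; split=> //; first exact: subset_trans KA (subsetDl _ _).
    apply/eqP; rewrite eqn_leq Kw omega_on_mono ?subsetDl //= leqNgt.
    apply: contra nA => lt;
      apply: (colorable_on_mono (B := A) (k := (omega_on G (A :\: I)).+1)) => //.
    by apply: (@colorable_on_setD_stable A I) => //; apply: IH.
  apply/eqP; rewrite setI_eq0 disjoint_sym; apply/pred0P => x /=.
  by apply: contraTF isT => /andP[/(subsetP KA)]; rewrite inE => /andP[/negbTE->].
have [I0 [I0A sI0 cI0]] := @omega_on_ex (compl G) A.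
pose V := {v : G | v \in I0}.
have /fin_all_exists[f fP] : forall v : V, exists f : G -> nat,
    {in A :\ val v, forall x, f x < w} /\
    {in A :\ val v &, forall x y, adj x y -> f x != f y}.
  move=> v; have vA := subsetP I0A _ (valP v).
  suff /colorable_onP[f f1 f2] : colorable_on G (A :\ val v) w by exists f.
  by apply: colorable_on_mono (IH _ (properD1 vA)); rewrite // omega_on_mono // subD1set.
pose J := option (V * 'I_w)%type.
pose S (t : J) : {set G} :=
  if t is Some (v, c) then [set x in A :\ val v | f v x == c] else I0.
have sS t : @clique (compl G) (S t).
  case: t => [[v c]|] //=; apply/clique_complP => x y; rewrite !inE.
  move=> /andP[/andP[xv xA] /eqP xc] /andP[/andP[yv yA] /eqP yc].
  apply/negP => xy; have [_ /(_ x y)] := fP v; rewrite !inE xv xA yv yA xc yc eqxx.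
  by move/(_ isT isT xy).
have /fin_all_exists[K KP] := fun t => avoid (S t) (sS t).
have inj v K' : clique K' -> K' \subset A :\ val v -> {in K' &, injective (f v)}.
  move=> /cliqueP cK' /subsetP KA x y xK yK /eqP; apply: contraTeq => xy.
  by apply: (fP v).2; rewrite ?KA ?cK'.
(* A maximum clique avoiding v meets all w colour classes of A - v. *)
have miss v c K' : clique K' -> K' \subset A -> #|K'| = w ->
    S (Some (v, c)) :&: K' = set0 -> val v \in K'.
  move=> cK' KA Kw SK0; apply: contraT => vK.
  have KAv : K' \subset A :\ val v by rewrite subsetD1 KA.
  suff: #|K'| < w by rewrite Kw ltnn.
  pose g x : 'I_w := insubd c (f v x).
  have gE x : x \in K' -> g x = f v x :> nat.
    by move=> xK; rewrite val_insubd (fP v).1 ?(subsetP KAv).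
  have gI : {in K' &, injective g}.
    move=> x y xK yK /(congr1 val); rewrite /= !gE //.
    exact: (inj v K').
  rewrite -(card_in_imset gI) -[w in _ < w]card_ord -cardsT; apply: proper_card.
  rewrite properT; apply: contraNneq vK => gT.
  have : c \in [set g x | x in K'] by rewrite gT inE.
  case/imsetP => x xK cE; have /setP/(_ x) := SK0.
  by rewrite !inE xK -gE // -cE eqxx /= -in_setD1 (subsetP KAv).
(* A maximum clique through v has w - 1 vertices left for the w classes of A - v. *)
have miss2 v c d K' : clique K' -> K' \subset A -> #|K'| = w ->
    S (Some (v, c)) :&: K' = set0 -> S (Some (v, d)) :&: K' = set0 -> c = d.
  move=> cK' KA Kw c0 d0; apply/eqP; apply: contraT => cd.
  have vK := miss v c K' cK' KA Kw c0.
  have KAv : K' :\ val v \subset A :\ val v by rewrite setSD.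
  have cKv : clique (K' :\ val v) by apply: clique_sub cK'; rewrite subD1set.
  pose g x : 'I_w := insubd c (f v x).
  have gE x : x \in K' :\ val v -> g x = f v x :> nat.
    by move=> xK; rewrite val_insubd (fP v).1 ?(subsetP KAv).
  have gI : {in K' :\ val v &, injective g}.
    move=> x y xK yK /(congr1 val); rewrite /= !gE //.
    exact: (inj v (K' :\ val v)).
  have sub : [set g x | x in K' :\ val v] \subset ~: [set c; d].
    apply/subsetP => _ /imsetP[x xK ->]; rewrite !inE; apply/norP; split.
      apply: contraTneq (xK) => e; move/setP: c0 => /(_ x).
      by rewrite !inE -e gE // eqxx andbT; case: (x =P val v) => //= _;
        case: (boolP (x \in K')) => [/(subsetP KA)->|].
    apply: contraTneq (xK) => e; move/setP: d0 => /(_ x).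
    by rewrite !inE -e gE // eqxx andbT; case: (x =P val v) => //= _;
      case: (boolP (x \in K')) => [/(subsetP KA)->|].
  suff : ~~ (#|K' :\ val v| <= w - 2).
    by have := subset_leq_card sub;
      rewrite card_in_imset // [#|~: _|]cardsCs setCK cards2 cd card_ord => ->.
  have := cardsD1 (val v) K'; rewrite vK Kw => wE.
  have w2 : 1 < w.
    by rewrite -[w]card_ord; apply/card_gt1P; exists c, d.
  by rewrite -(leq_add2r 2) subnK // wE addnC leq_add2r.
have SK t u : #|S t :&: K u| = (t != u) :> nat.
  have [KA cK Kw SK0] := KP u.
  case: (eqVneq t u) => [->|tu] /=; first by rewrite SK0 cards0.
  apply/eqP; rewrite eqn_leq stable_clique //= card_gt0.
  apply: contraNneq tu => St0; apply/eqP.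
  case: t u KA cK Kw SK0 St0 => [[v c]|] [[v' c']|] KA cK Kw SK0 St0 //.
  - have vK := miss _ _ _ cK KA Kw St0; have vK' := miss _ _ _ cK KA Kw SK0.
    have vv : v = v'.
      have /card_le1_eqP := stable_clique sI0 cK => /(_ (val v) (val v')).
      by rewrite !inE vK vK' (valP v) (valP v') => /(_ isT isT)/val_inj.
    subst v'; congr (Some (_, _)); exact: miss2 St0 SK0.
  - have vK := miss _ _ _ cK KA Kw St0; move/setP/(_ (val v)): SK0.
    by rewrite !inE vK (valP v).
  - have vK := miss _ _ _ cK KA Kw SK0; move/setP/(_ (val v')): St0.
    by rewrite !inE vK (valP v').
have cJ : #|{: J}| = (omega_on (compl G) A * w).+1.
  by rewrite card_option card_prod card_ord card_sig -cI0.
have J1 : 1 < #|{: J}|.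
  by rewrite cJ ltnS muln_gt0 w0 andbT; exact: (@omega_on_gt0 (compl G) A x0).
have := card_le_of_cross_intersections J1 (fun t => let: And4 KA _ _ _ := KP t in KA) SK.
by rewrite cJ mulnC ltnNge cA.
Qed.

(** Lovasz's characterization of perfection. *)
Lemma perfect_on_count A :
  perfect_on G A <-> (forall B, B \subset A -> #|B| <= omega_on G B * omega_on (compl G) B).
Proof.
split=> [pA B BA|]; first by apply/card_le_colorable_on/pA.
move=> cA B; have [n] := ubnP #|B|; elim: n B => // n IH B; rewrite ltnS => Bn BA.
apply: colorable_on_of_count; last exact: cA.
move=> C CB; apply: IH; first exact: leq_trans (proper_card CB) Bn.
exact: subset_trans (proper_sub CB) BA.
Qed.
End Gasparyan.

Lemma clique_complK (G : sgraph) (K : {set G}) :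
  @clique (compl (compl G)) K = clique K.
Proof.
apply/cliqueP/cliqueP => cK x y xK yK xy; have := cK x y xK yK xy;
  by rewrite -(@adj_complK G).
Qed.

Lemma omega_on_complK (G : sgraph) (A : {set G}) : omega_on (compl (compl G)) A =
  omega_on G A.
Proof. by apply: eq_bigl => K; rewrite clique_complK. Qed.

Lemma perfect_on_compl (G : sgraph) (A : {set G}) : perfect_on (compl G) A <-> perfect_on
  G A.
Proof.
split=> /perfect_on_count cA; apply/perfect_on_count => B /cA;
  rewrite ?omega_on_complK mulnC //.
Qed.

(** * Classes of perfect graphs, and Ramsey's theorem *)

Lemma clique_setU1 (G : sgraph) x (K : {set G}) : clique K ->
  {in K, forall y, adj x y} -> clique (x |: K).
Proof.
move=> /cliqueP cK xK; apply/cliqueP => u v; rewrite !inE.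
move=> /predU1P[->|uK] /predU1P[->|vK] uv; first by rewrite eqxx in uv.
- exact: xK.
- by rewrite adj_sym xK.
- exact: cK.
Qed.

(** Otherwise [x] could be added to [K]. *)
Lemma max_clique_nonadj (G : sgraph) (B K : {set G}) x : K \subset B -> clique K ->
  #|K| = omega_on G B ->
  x \in B -> x \notin K -> exists2 k, k \in K & ~~ adj x k.
Proof.
move=> KB cK mK xB xK; apply/exists_inP; apply: contraT => /exists_inPn xadj.
have: #|x |: K| <= omega_on G B.
  apply: omega_on_ge; first by rewrite subUset sub1set xB.
  by apply: clique_setU1 => // y yK; apply/negPn/xadj.
by rewrite cardsU1 xK -mK add1n ltnn.
Qed.

Section PerfectClasses.
Variable G : sgraph.
Implicit Types A B K I : {set G}.

(** Removing such a stable set lowers the clique number, so it can be used as one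
    colour class, and induction colours the rest. *)
Lemma perfect_on_stable_transversal A :
  (forall B, B \subset A -> B != set0 -> exists2 I, @clique (compl G) I &
     forall K, K \subset B -> clique K -> #|K| = omega_on G B -> I :&: K != set0) ->
  perfect_on G A.
Proof.
move=> hit B; have [n] := ubnP #|B|; elim: n B => // n IH B; rewrite ltnS => Bn BA.
case: (eqVneq B set0) => [->|B0].
  by apply/colorable_onP; exists (fun=> 0) => x; rewrite inE.
have [I sI hI] := hit B BA B0.
have lt_omega : omega_on G (B :\: I) < omega_on G B.
  rewrite ltnNge; apply/negP => le; have [K [KB cK mK]] := omega_on_ex (B :\: I).
  have KB' := subset_trans KB (subsetDl B I).
  have eK : #|K| = omega_on G B by apply/eqP; rewrite eqn_leq omega_on_ge //= mK.
  case/set0Pn: (hI K KB' cK eK) => x; rewrite inE => /andP[xI /(subsetP KB)].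
  by rewrite inE xI.
have BIA : B :\: I \subset A := subset_trans (subsetDl B I) BA.
have pr : B :\: I \proper B.
  by rewrite properEneq subsetDl andbT; apply: contraTneq lt_omega => ->; rewrite ltnn.
have := IH _ (leq_trans (proper_card pr) Bn) BIA.
by move/(colorable_on_setD_stable sI); apply: colorable_on_mono.
Qed.

Definition P4_free_on A := forall a b c d,
  all (fun x => x \in A) [:: a; b; c; d] ->
  adj_code (@adj G) [:: a; b; c; d] <> [:: true; false; false; true; false; true].

(** A maximum stable set I meets every maximum clique K.  If not, let i in I have
    as many neighbours in K as possible, k in K a non-neighbour of i, and j in I a
    neighbour of k.  By the choice of i, some l in K is adjacent to i but not to
    j, and i - l - k - j is an induced P4. *)
Lemma perfect_on_P4_free A : P4_free_on A -> perfect_on G A.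
Proof.
move=> nP4; apply: perfect_on_stable_transversal => B /subsetP BA /set0Pn[x0 x0B].
have [I [IB sI mI]] : exists I : {set G}, [/\ I \subset B, @clique (compl G) I
    & #|I| = omega_on (compl G) B] := @omega_on_ex (compl G) B.
exists I => // K KB cK mK; apply/negP => /eqP IK0.
have IK x : x \in I -> x \in K -> False.
  by move=> xI xK; have := in_set0 x; rewrite -IK0 inE xI xK.
have [i0 i0I] : exists i, i \in I.
  by apply/card_gt0P; rewrite mI; apply: (@omega_on_gt0 (compl G) B x0).
case: (@arg_maxnP _ i0 (mem I) (fun i => #|[set k in K | adj i k]|) i0I) => i iI maxi.
have iK : i \notin K by apply/negP/IK.
have [k kK ik] := max_clique_nonadj KB cK mK (subsetP IB _ iI) iK.
have kI : k \notin I by apply/negP => kI; apply: IK kI kK.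
have [j jI kj] : exists2 j, j \in I & adj k j.
  have [j jI] := @max_clique_nonadj (compl G) B I k IB sI mI (subsetP KB _ kK) kI.
  rewrite /= /compl_adj negb_and !negbK => /orP[/eqP kj|]; last by exists j.
  by case: (IK k); rewrite // kj.
have [l lK /andP[il jl]] : exists2 l, l \in K & adj i l && ~~ adj j l.
  apply/exists_inP; apply: contraT => /exists_inPn sub.
  have : #|[set k in K | adj i k]| < #|[set k in K | adj j k]|.
    apply: proper_card; apply/properP; split.
      apply/subsetP => l; rewrite !inE => /andP[lK il]; rewrite lK /=.
      by have := sub l lK; rewrite il negbK.
    by exists k; rewrite inE kK ?(negbTE ik) // adj_sym.
  by rewrite ltnNge => /negP[]; apply: maxi.
have lk : adj l k.
  by move/cliqueP: cK; apply=> //; apply: contraNneq ik => <-.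
have ij : ~~ adj i j by move/clique_complP: sI; apply.
apply: (nP4 i l k j).
  by rewrite /= (BA i) ?(BA l) ?(BA k) ?(BA j) ?(subsetP IB i) ?(subsetP IB j)
    ?(subsetP KB k) ?(subsetP KB l).
by rewrite /= il (negbTE ik) (negbTE ij) lk adj_sym (negbTE jl) kj.
Qed.

Lemma perfect_on_bipartite A (X Y : {set G}) :
  @clique (compl G) X -> @clique (compl G) Y -> A \subset X :|: Y ->
  perfect_on G A.
Proof.
move=> /clique_complP sX /clique_complP sY AXY B BA; apply/colorable_onP.
have BXY x : x \in B -> x \notin X -> x \in Y.
  by move=> /(subsetP BA)/(subsetP AXY); rewrite inE => /orP[->|].
case: (boolP [exists x in B, exists y in B, adj x y]) => [|noedge].
  case/exists_inP => a aB /exists_inP[b bB ab]; exists (fun x => (x \in X) : nat).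
    by move=> x xB; apply: leq_ltn_trans (leq_b1 _) (omega_on_gt1 aB bB ab).
  move=> x y xB yB xy; case: (boolP (x \in X)) (boolP (y \in X)) => xX [] yX //.
    by have := sX x y xX yX; rewrite xy.
  by have := sY x y (BXY x xB xX) (BXY y yB yX); rewrite xy.
exists (fun=> 0) => [x|x y xB yB xy]; first exact: omega_on_gt0.
by case/exists_inP: noedge; exists x => //; apply/exists_inP; exists y.
Qed.

(** Number the clique and give each vertex the number of its first non-neighbour
    in the clique.  A vertex of the clique gets its own number, so colours clash
    only between non-adjacent vertices.  An extra colour is used only for
    vertices that enlarge the clique. *)
Lemma perfect_on_split A K I :
  clique K -> @clique (compl G) I -> A \subset K :|: I -> perfect_on G A.
Proof.
move=> /cliqueP cK /clique_complP sI AKI B BA; apply/colorable_onP.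
pose s := enum (B :&: K); pose f x := find (fun k => ~~ adj x k) s.
have sP k : (k \in s) = (k \in B) && (k \in K) by rewrite mem_enum inE.
have sz : size s = #|B :&: K| by rewrite cardE.
have cBK : clique (B :&: K) by apply/cliqueP => x y /setIP[_ xK] /setIP[_]; apply: cK.
(* A vertex of the clique is its own first non-neighbour there. *)
have fK x : x \in s -> f x < size s /\ nth x s (f x) = x.
  move=> xs; have hx : has (fun k => ~~ adj x k) s.
    by apply/hasP; exists x; rewrite // adj_irr.
  split; first by rewrite -has_find.
  apply/eqP; apply: contraT; rewrite eq_sym => nx.
  have ns : nth x s (f x) \in s by rewrite mem_nth // -has_find.
  have := nth_find x hx; rewrite -/(f x) cK //.
    by move: xs; rewrite sP => /andP[].
  by move: ns; rewrite sP => /andP[].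
exists f => [x xB|].
  case: (boolP (has (fun k => ~~ adj x k) s)) => [hx|nhx].
    by apply: leq_trans (omega_on_ge (subsetIl B K) cBK); rewrite -sz -has_find.
  have xs : x \notin s.
    by apply: contra nhx => xs; apply/hasP; exists x; rewrite ?adj_irr.
  have fx : f x <= #|B :&: K| by rewrite -sz find_size.
  apply: leq_trans (_ : #|x |: (B :&: K)| <= _).
    by move: xs; rewrite mem_enum cardsU1 => ->; rewrite add1n ltnS.
  apply: omega_on_ge; first by rewrite subUset sub1set xB subsetIl.
  apply: clique_setU1 => // y; rewrite -mem_enum => ys.
  by apply: contraR nhx => nxy; apply/hasP; exists y.
have key x y : x \in s -> adj x y -> f x != f y.
  move=> xs xy; have [lt nx] := fK x xs; apply: contraTneq xy => e.
  have : has (fun k => ~~ adj y k) s by rewrite has_find -/(f y) -e.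
  by move/(nth_find x); rewrite -/(f y) -e nx adj_sym.
move=> x y xB yB xy; case: (boolP (x \in s)) => [xs|xs]; first exact: key.
case: (boolP (y \in s)) => [ys|ys]; first by rewrite eq_sym key // adj_sym.
have inI z : z \in B -> z \notin s -> z \in I.
  move=> zB; have := subsetP AKI _ (subsetP BA _ zB).
  by rewrite sP zB inE; case: (z \in K).
by have := sI x y (inI x xB xs) (inI y yB ys); rewrite xy.
Qed.

(** Both sides may use the same colours, and neither needs more than the clique
    number of the union. *)
Lemma perfect_on_disconnected A (U V : {set G}) :
  (forall x y, x \in U -> y \in V -> ~~ adj x y) -> A \subset U :|: V ->
  perfect_on G U -> perfect_on G V -> perfect_on G A.
Proof.
move=> UV AUV pU pV B BA.
have /colorable_onP[f fk fP] : colorable_on G (B :&: U) (omega_on G B).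
  by apply: colorable_on_mono (pU _ (subsetIr B U)); rewrite // omega_on_mono // subsetIl.
have /colorable_onP[g gk gP] : colorable_on G (B :&: V) (omega_on G B).
  by apply: colorable_on_mono (pV _ (subsetIr B V)); rewrite // omega_on_mono // subsetIl.
have inV x : x \in B -> x \notin U -> x \in V.
  by move=> /(subsetP BA)/(subsetP AUV); rewrite inE => /orP[->|].
apply/colorable_onP; exists (fun x => if x \in U then f x else g x) => [x xB|].
  by case: ifPn => xU; [apply: fk | apply: gk]; rewrite inE xB ?inV.
move=> x y xB yB xy; case: (boolP (x \in U)) => xU; case: (boolP (y \in U)) => yU.
- by apply: fP; rewrite ?inE ?xB ?yB.
- by have := UV x y xU (inV y yB yU); rewrite xy.
- by have := UV y x yU (inV x xB xU); rewrite adj_sym xy.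
- by apply: gP; rewrite ?inE ?xB ?yB ?inV.
Qed.

Lemma perfect_on_set0 : perfect_on G set0.
Proof.
move=> B; rewrite subset0 => /eqP ->.
by apply/colorable_onP; exists (fun=> 0) => x; rewrite inE.
Qed.

(** The neighbours or the non-neighbours of a vertex make up at least half of the
    remaining vertices. *)
Lemma ramsey p q A : 2 ^ (p + q) <= #|A| ->
  (exists K, [/\ K \subset A, clique K & #|K| = p]) \/
  (exists I, [/\ I \subset A, @clique (compl G) I & #|I| = q]).
Proof.
have [n] := ubnP (p + q); elim: n p q A => // n IH [|p] [|q] A; rewrite ltnS => pqn cA.
- by left; exists set0; rewrite sub0set cards0; split=> //; apply/cliqueP => x y;
  rewrite inE.
- by left; exists set0; rewrite sub0set cards0; split=> //; apply/cliqueP => x y;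
  rewrite inE.
- by right; exists set0; rewrite sub0set cards0; split=> //; apply/clique_complP => x y;
  rewrite inE.
have /card_gt0P[x xA] : 0 < #|A| by apply: leq_trans cA; rewrite expn_gt0.
pose N := [set y in A | adj x y]; pose M := [set y in A :\ x | ~~ adj x y].
have cNM : #|A| = (#|N| + #|M|).+1.
  rewrite (cardsD1 x A) xA add1n -(cardsID [set y | adj x y] (A :\ x)).
  congr (_ + _).+1; apply: eq_card => y; rewrite !inE; last by rewrite andbC.
  by case: (eqVneq y x) => [->|_] //=; rewrite adj_irr andbF.
have [cN|cM] : 2 ^ (p + q.+1) <= #|N| \/ 2 ^ (p.+1 + q) <= #|M|.
  rewrite addSnnS; case: (leqP (2 ^ (p + q.+1)) #|N|) => ltN; first by left.
  case: (leqP (2 ^ (p + q.+1)) #|M|) => ltM; first by right.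
  move: cA; rewrite cNM addSn expnS mul2n -addnn leqNgt; case/negP.
  by rewrite -addSn -addnS leq_add.
- have pq : p + q.+1 < n by rewrite -addSn.
  have NA : N \subset A by apply/subsetP => y; rewrite inE => /andP[].
  case: (IH _ _ _ pq cN) => [[K [KN cK cKp]]|[I [IN sI cIq]]]; last first.
    by right; exists I; rewrite (subset_trans IN).
  have xK : x \notin K.
    by apply: contraT => /negbNE /(subsetP KN); rewrite inE adj_irr andbF.
  left; exists (x |: K); rewrite cardsU1 xK cKp; split=> //.
    by rewrite subUset sub1set xA (subset_trans KN).
  by apply: clique_setU1 => // y /(subsetP KN); rewrite inE => /andP[].
have pq : p.+1 + q < n by rewrite addSnnS -addSn.
have MA : M \subset A by apply/subsetP => y; rewrite !inE => /andP[/andP[]].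
case: (IH _ _ _ pq cM) => [[K [KM cK cKp]]|[I [IM sI cIq]]].
  by left; exists K; rewrite (subset_trans KM).
have xI : x \notin I.
  by apply: contraT => /negbNE /(subsetP IM); rewrite !inE eqxx.
right; exists (x |: I); rewrite cardsU1 xI cIq; split=> //.
  by rewrite subUset sub1set xA (subset_trans IM).
apply: (@clique_setU1 (compl G)) => // y /(subsetP IM); rewrite !inE.
by case/andP => /andP[yx _] xy; rewrite /= /compl_adj eq_sym yx.
Qed.
End PerfectClasses.

(** * Recognizing small induced subgraphs *)

Notation paw := (compl (disjoint_union (path_graph 3) (complete 1))).
Notation codiamond := (disjoint_union (complete 2) (copies (complete 1) 2)).
Notation ordk n i := (@Ordinal n i isT).

Section Patterns.
Variables (G : sgraph) (a b c d : G).

Lemma embeds_P4 : uniq [:: a; b; c; d] ->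
  adj_code (@adj G) [:: a; b; c; d] = [:: true; false; false; true; false; true] ->
  embeds (path_graph 4) G.
Proof.
move=> us ts.
by apply: (@embeds_seq (path_graph 4) G [:: ordk 4 0; ordk 4 1; ordk 4 2;
  ordk 4 3]) us _ _ => //; case=> [[|[|[|[|?]]]] ?].
Qed.

Lemma embeds_C4 : uniq [:: a; b; c; d] ->
  adj_code (@adj G) [:: a; b; c; d] = [:: true; false; true; true; false; true] ->
  embeds (cycle_graph 4) G.
Proof.
move=> us ts.
by apply: (@embeds_seq (cycle_graph 4) G [:: ordk 4 0; ordk 4 1; ordk 4 2;
  ordk 4 3]) us _ _ => //; case=> [[|[|[|[|?]]]] ?].
Qed.

Lemma embeds_2K2 : uniq [:: a; b; c; d] ->
  adj_code (@adj G) [:: a; b; c; d] = [:: true; false; false; false; false; true] ->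
  embeds (copies (complete 2) 2) G.
Proof.
move=> us ts.
by apply: (@embeds_seq (copies (complete 2) 2) G [:: (ordk 2 0, ordk 2 0);
  (ordk 2 0, ordk 2 1); (ordk 2 1, ordk 2 0); (ordk 2 1, ordk 2 1)]) us _ _ => //;
    case=> [[[|[|?]] ?] [[|[|?]] ?]].
Qed.

Lemma embeds_codiamond : uniq [:: a; b; c; d] ->
  adj_code (@adj G) [:: a; b; c; d] = [:: true; false; false; false; false; false] ->
  embeds codiamond G.
Proof.
move=> us ts.
by apply: (@embeds_seq codiamond G [:: inl (ordk 2 0); inl (ordk 2 1);
  inr (ordk 2 0, ordk 1 0); inr (ordk 2 1, ordk 1 0)]) us _ _ => //;
    case=> [[[|[|?]] ?]|[[[|[|?]] ?] [[|?] ?]]].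
Qed.

Lemma embeds_diamond : uniq [:: a; b; c; d] ->
  adj_code (@adj G) [:: a; b; c; d] = [:: false; true; true; true; true; true] ->
  embeds (compl codiamond) G.
Proof.
move=> us ts.
by apply: (@embeds_seq (compl codiamond) G [:: inl (ordk 2 0); inl (ordk 2 1);
  inr (ordk 2 0, ordk 1 0); inr (ordk 2 1, ordk 1 0)]) us _ _ => //;
    case=> [[[|[|?]] ?]|[[[|[|?]] ?] [[|?] ?]]].
Qed.

Lemma embeds_paw : uniq [:: a; b; c; d] ->
  adj_code (@adj G) [:: a; b; c; d] = [:: true; false; false; true; true; true] ->
  embeds paw G.
Proof.
move=> us ts.
by apply: (@embeds_seq paw G [:: inl (ordk 3 1); inr (ordk 1 0); inl (ordk 3 0);
  inl (ordk 3 2)]) us _ _ => //; case=> [[[|[|[|?]]] ?]|[[|?] ?]].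
Qed.

(** The vertices of [I] are distinct from [a], [b] and [c] because each of these
    three has a neighbour on the path, whereas they have none. *)
Lemma embeds_P3_rK1 r (I : {set G}) :
  r <= #|I| -> a != c -> adj a b -> adj b c -> ~~ adj a c ->
  @clique (compl G) I -> {in I, forall i, [/\ ~~ adj a i, ~~ adj b i & ~~ adj c i]} ->
  embeds (disjoint_union (path_graph 3) (copies (complete 1) r)) G.
Proof.
move=> rI ac ab bc nac /clique_complP sI far.
have [ab' bc'] : a != b /\ b != c.
  by split; [apply: contraTneq ab | apply: contraTneq bc] => ->; rewrite adj_irr.
pose f (u : disjoint_union (path_graph 3) (copies (complete 1) r)) : G :=
  match u with inl i => nth a [:: a; b; c] i | inr (j, _) => enum_val (widen_ord rI j) end.
have fI j : enum_val (widen_ord rI j) \in I := enum_valP _.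
have nI z : z \in I -> [/\ a != z, b != z & c != z].
  move=> zI; have [az bz cz] := far z zI; split.
  - by apply: contraNneq bz => <-; rewrite adj_sym.
  - by apply: contraNneq az => <-.
  - by apply: contraNneq bz => <-.
apply/embedsP; exists f.
  case=> [i|[i j]] [k|[k l]] /= e.
  - congr inl; apply/val_inj/eqP; rewrite -(nth_uniq a _ _ (s := [:: a; b; c])) ?ltn_ord //.
      by rewrite e.
    by rewrite /= !inE negb_or ab' ac bc'.
  - have [] := nI _ (fI k); rewrite -e; case: i {e} => [[|[|[|?]]] ?] //=;
    by rewrite eqxx.
  - have [] := nI _ (fI i); rewrite e; case: k {e} => [[|[|[|?]]] ?] //=;
    by rewrite eqxx.
  - by move/enum_val_inj: e => [] /val_inj ->; rewrite (ord1 j) (ord1 l).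
case=> [i|[i j]] [k|[k l]] /=.
- by case: i k => [[|[|[|?]]] ?] [[|[|[|?]]] ?] //=;
  rewrite ?adj_irr ?ab ?bc ?(negbTE nac) 1?adj_sym ?ab ?bc ?(negbTE nac).
- by have [] := far _ (fI k); case: i => [[|[|[|?]]] ?] //= *; apply/negbTE.
- by rewrite adj_sym; have [] := far _ (fI i); case: k => [[|[|[|?]]] ?] //= *;
  apply/negbTE.
- by rewrite /copies_adj /= (ord1 j) (ord1 l) /complete_adj eqxx andbF; apply/negbTE/sI.
Qed.

End Patterns.

Lemma embeds_complete (H G : sgraph) (K : {set G}) :
  is_complete H -> clique K -> #|H| <= #|K| -> embeds H G.
Proof.
move=> cH /cliqueP cK le; apply/embedsP.
pose f (x : H) : G := enum_val (widen_ord le (enum_rank x)).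
have fI : injective f by move=> x y /enum_val_inj [] /val_inj /enum_rank_inj.
exists f => // x y; case: (eqVneq x y) => [->|xy]; first by rewrite !adj_irr.
by rewrite cH // cK ?enum_valP // (inj_eq fI).
Qed.

Definition triangle_free (G : sgraph) := forall a b c : G,
  adj a b -> adj b c -> adj a c -> False.
Definition square_free (G : sgraph) := forall a b c d : G,
  adj a b -> adj b c -> adj c d -> adj d a -> ~~ adj a c -> ~~ adj b d ->
  a != c -> b != d -> False.
Definition C5 (G : sgraph) (a b c d e : G) : bool :=
  [&& adj a b, adj b c, adj c d, adj d e & adj e a] &&
      [&& ~~ adj a c, ~~ adj b d, ~~ adj c e, ~~ adj d a & ~~ adj e b].
Definition pentagon_free (G : sgraph) := forall a b c d e : G,
  C5 a b c d e -> False.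
Definition degree_le2 (G : sgraph) := forall x a b c : G,
  adj x a -> adj x b -> adj x c -> a != b -> b != c -> a != c -> False.
Definition two_edge_free (G : sgraph) := forall a b c d : G,
  adj a b -> adj c d -> ~~ adj a c -> ~~ adj a d -> ~~ adj b c -> ~~ adj b d -> False.
Definition P4_K1_free (G : sgraph) := forall a b c d x : G,
  adj a b -> adj b c -> adj c d -> ~~ adj a c -> ~~ adj a d -> ~~ adj b d ->
  [&& ~~ adj x a, ~~ adj x b, ~~ adj x c & ~~ adj x d] -> False.

Ltac adj_clash := match goal with
 | H : is_true (adj ?x ?x) |- _ => by rewrite adj_irr in H
 | H : is_true (adj ?x ?y), K : is_true (~~ adj ?x ?y) |- _ => by rewrite H in K
 | H : is_true (adj ?x ?y), K : is_true (~~ adj ?y ?x) |- _ => by rewrite adj_sym H in K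
 end.
(** Two vertices are distinct when identifying them would make some pair of
    vertices both adjacent and non-adjacent, or some vertex adjacent to itself. *)
Ltac distinct :=
  first [assumption | by rewrite eq_sym | by apply/eqP => ?; subst; adj_clash].
Ltac uniq_tac :=
  rewrite /= ?inE ?negb_or; repeat (apply/andP; split); first [done | distinct].
Ltac adj_tac := match goal with
 | |- adj _ _ = true => first [assumption | by rewrite adj_sym]
 | |- adj _ _ = false => apply/negbTE; first [assumption | by rewrite adj_sym]
 end.
Ltac adj_code_tac := rewrite /=; repeat (congr cons); adj_tac.
Ltac pattern_tac := first [uniq_tac | adj_code_tac].

(** * Excluding the paw and P3 + rK1 *)

Section PawFree.
Variables (G : sgraph) (r : nat).
Implicit Types A B K I : {set G}.
Hypothesis noPaw : ~~ embeds paw G.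
Hypothesis noP3r :
  ~~ embeds (disjoint_union (path_graph 3) (copies (complete 1) r)) G.

Lemma paw_free (a b c d : G) : adj a b -> adj b c -> adj b d -> adj c d ->
  adj a c || adj a d.
Proof.
move=> ab bc bd cd; apply: contraT; rewrite negb_or => /andP[ac ad].
by case/negP: noPaw; apply: (embeds_paw (a := a) (b := b) (c := c) (d := d)); pattern_tac.
Qed.

Definition in_triangle : {set G} :=
  [set x | [exists y, exists z, [&& adj x y, adj x z & adj y z]]].

Lemma in_triangleP x :
  reflect (exists y z, [/\ adj x y, adj x z & adj y z]) (x \in in_triangle).
Proof.
rewrite inE; apply: (iffP existsP) => [[y /existsP[z /and3P[]]]|[y [z [xy xz yz]]]].
  by exists y, z.
by exists y; apply/existsP; exists z; rewrite xy xz yz.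
Qed.

(** A neighbour of a triangle is adjacent to a second vertex of the triangle,
    since otherwise they would induce a paw. *)
Lemma triangle_edge x y : x \in in_triangle -> adj x y ->
  exists z, adj x z && adj y z.
Proof.
case/in_triangleP => u [v [xu xv uv]] xy.
have : adj y u || adj y v by apply: (paw_free (b := x)); rewrite // adj_sym.
by case/orP => ?; [exists u | exists v]; apply/andP.
Qed.

(** Thus the vertices lying in triangles form a union of components. *)
Lemma in_triangle_adj x y : x \in in_triangle -> adj x y -> y \in in_triangle.
Proof.
move=> xT xy; have [z /andP[xz yz]] := triangle_edge xT xy.
by apply/in_triangleP; exists x, z; rewrite adj_sym.
Qed.

(** If a - b - c - d were an induced P4, the edge bc would lie in a triangle bcz.
    The absence of paws makes z adjacent to a and to d, and then d, z, a, b
    induce a paw. *)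
Lemma perfect_on_in_triangle : perfect_on G in_triangle.
Proof.
apply: perfect_on_P4_free => a b c d /and5P[aT bT cT dT _] /= [ab ac ad bc bd cd].
have [z /andP[bz cz]] := triangle_edge bT bc.
have az : adj a z by have := paw_free ab bc bz cz; rewrite ac.
have dz : adj d z.
  have := @paw_free d c b z; rewrite [adj d b]adj_sym bd /=; apply=> //;
  by rewrite adj_sym.
have := @paw_free d z a b; rewrite [adj d a]adj_sym ad [adj d b]adj_sym bd /=.
suff [za zb] : adj z a /\ adj z b by move/(_ dz za zb ab).
by split; rewrite adj_sym.
Qed.

(** With D = 2r + 4 and R = 2^(3 + r): when all degrees are below D, three
    neighbourhoods and at most R further vertices are removed; otherwise two sets
    of at most R vertices. *)
Definition near_bipartite_bound := 3 * (2 * r + 4) + 2 * 2 ^ (3 + r).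

Section TriangleFree.
Variable U : {set G}.
Hypothesis triU : forall a b c, a \in U -> b \in U -> c \in U ->
  adj a b -> adj b c -> adj a c -> False.

Definition far (a b c : G) : {set G} :=
  [set x in U | [&& ~~ adj a x, ~~ adj b x & ~~ adj c x]].

Lemma card_stable_far (a b c : G) I : a != c -> adj a b -> adj b c -> ~~ adj a c ->
  @clique (compl G) I -> I \subset far a b c -> #|I| < r.
Proof.
move=> ac ab bc nac sI /subsetP If; rewrite ltnNge; apply: contra noP3r => rI.
apply: (embeds_P3_rK1 rI ac ab bc nac sI) => i /If.
by rewrite inE => /andP[_ /and3P[]].
Qed.

(** By Ramsey's theorem a larger set would contain a triangle or, with the path,
    an induced P3 + rK1. *)
Lemma card_far (a b c : G) : a != c -> adj a b -> adj b c -> ~~ adj a c ->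
  #|far a b c| < 2 ^ (3 + r).
Proof.
move=> ac ab bc nac; rewrite ltnNge;
  apply/negP => /(@ramsey G)[[K [KF cK K3]]|[I [IF sI Ir]]].
  have KU x : x \in K -> x \in U by move/(subsetP KF); rewrite inE => /andP[].
  have /card_gt2P[x [y [z [[xK yK zK] [xy yz zx]]]]] : 2 < #|K| by rewrite K3.
  move/cliqueP: cK => cK.
  by apply: (triU (KU x xK) (KU y yK) (KU z zK)); apply: cK; rewrite // eq_sym.
by have := card_stable_far ac ab bc nac sI IF; rewrite Ir ltnn.
Qed.

(** If every vertex has few neighbours in [U], an induced P3 and its
    neighbourhoods exhaust [U] up to boundedly many vertices, while a set without
    induced P3 is P4-free.  Otherwise let b have a large neighbourhood M, which is
    stable.  A vertex with two neighbours in M misses fewer than r vertices of M,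
    because with these neighbours it forms an induced P3.  Two such vertices have
    a common neighbour, hence are not adjacent; so these vertices form a second
    stable set, which contains b.  The vertices outside M with at most one
    neighbour in M are few: given two disjoint pairs in M, each of them is far
    from one of the two paths that the pairs form with b. *)
Lemma near_bipartite :
  exists2 S : {set G}, #|S| <= near_bipartite_bound & perfect_on G (U :\: S).
Proof.
set D := 2 * r + 4; set R := 2 ^ (3 + r).
case: (boolP [exists b in U, D <= #|[set x in U | adj b x]|]) => [|small]; last first.
  case: (boolP [exists a in U, exists b in U, exists c in U,
                 [&& a != c, adj a b & adj b c]]) => [|noP3].
    case/exists_inP=> a aU /exists_inP[b bU /exists_inP[c cU /and3P[ac ab bc]]].
    have nac : ~~ adj a c by apply/negP => /(triU aU bU cU ab bc).
    have nbr x : x \in U -> #|[set y in U | adj x y]| <= D.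
      by move=> xU; move/exists_inPn/(_ x xU): small; rewrite -ltnNge => /ltnW.
    exists U; last first.
      by rewrite setDv => B; rewrite subset0 => /eqP ->; apply/colorable_onP;
         exists (fun=> 0) => x; rewrite inE.
    have sub : U \subset ([set y in U | adj a y] :|: [set y in U | adj b y]
                 :|: [set y in U | adj c y]) :|: far a b c.
      apply/subsetP => x xU; rewrite !inE xU /=.
      by case: (adj a x) (adj b x) (adj c x) => [] [] [].
    apply: leq_trans (subset_leq_card sub) _.
    apply: leq_trans (leq_card_setU _ _) _.
    rewrite /near_bipartite_bound -/D -/R leq_add //.
      rewrite !mulSn mul0n addn0 addnA.
      apply: leq_trans (leq_card_setU _ _) _; rewrite leq_add ?nbr //.
      by apply: leq_trans (leq_card_setU _ _) _; rewrite leq_add ?nbr.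
    by apply: leq_trans (ltnW (card_far ac ab bc nac)) _; rewrite leq_pmull.
  exists set0; first by rewrite cards0.
  apply: perfect_on_P4_free => a b c d; rewrite setD0.
  move=> /and5P[aU bU cU dU _] /= [ab _ ad bc _ cd].
  move/exists_inPn/(_ a aU)/exists_inPn/(_ b bU)/exists_inPn/(_ c cU): noP3.
  by rewrite ab bc !andbT negbK => /eqP ac; rewrite -ac ad in cd.
case/exists_inP => b bU; set M := [set x in U | adj b x] => DM.
have MP x : x \in M -> x \in U /\ adj b x by rewrite inE => /andP[].
have sM : @clique (compl G) M.
  apply/clique_complP => x y /MP[xU bx] /MP[yU by_]; apply/negP => xy.
  by apply: (triU bU xU yU).
pose low y := #|[set m in M | adj y m]| <= 1.
pose Y0 := [set y in U | (y \notin M) && low y].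
pose Z := [set y in U | (y \notin M) && ~~ low y].
exists Y0; last first.
  apply: (@perfect_on_bipartite _ _ M Z sM); last first.
    by apply/subsetP => x; rewrite !inE; case: (x \in U) => //=; case: (adj b x) => //=;
      case: (low x).
  have ZP y : y \in Z -> y \in U /\ #|[set m in M | ~~ adj y m]| < r.
    rewrite inE => /and3P[yU yM]; rewrite /low -ltnNge => /card_gt1P[m [n []]].
    rewrite !inE => /andP[/andP[mU bm] ym] /andP[/andP[nU bn] yn] mn; split=> //.
    apply: (@card_stable_far m y n); rewrite // 1?adj_sym //.
    - by apply/negP => nm; apply: (triU bU nU mU).
    - by apply: clique_sub sM; apply/subsetP => x; rewrite inE => /andP[].
    apply/subsetP => x; rewrite !inE => /andP[/andP[xU bx] yx]; rewrite xU yx /=.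
    apply/andP; split; apply/negP => ?; last by apply: (triU bU nU xU).
    by apply: (triU bU mU xU).
  apply/clique_complP => y z /ZP[yU yr] /ZP[zU zr]; apply/negP => yz.
  have sub : M \subset [set m in M | ~~ adj y m] :|: [set m in M | ~~ adj z m].
    apply/subsetP => m mM; rewrite !in_set; move: (mM); rewrite inE => /andP[mU bm];
      rewrite mU bm /=.
    rewrite -negb_and; apply/negP => /andP[ym zm]; apply: (triU yU zU mU) => //.
  have := leq_trans DM (leq_trans (subset_leq_card sub) (leq_card_setU _ _)).
  rewrite leqNgt; case/negP; apply: leq_ltn_trans (leq_add (ltnW yr) (ltnW zr)) _.
  by rewrite /D mul2n -addnn addnS ltnS leq_addr.
have /card_gt1P[a [c [aM cM ac]]] : 1 < #|M|.
  by apply: leq_trans DM; rewrite /D addnC.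
have /card_gt1P[a' [c' [a'M c'M ac']]] : 1 < #|M :\: [set a; c]|.
  rewrite -(leq_add2l #|M :&: [set a; c]|) cardsID.
  apply: leq_trans DM; rewrite /D -[in X in _ <= X](addn2 2) addnA leq_add2r.
  by apply: leq_trans (subset_leq_card (subsetIr _ _)) _; rewrite cards2 ac leq_addl.
have farM u v : u \in M -> v \in M -> u != v -> #|far u b v| < R.
  move=> uM vM uv; have [uU bu] := MP u uM; have [vU bv] := MP v vM.
  apply: card_far; rewrite // 1?adj_sym //.
  by move/clique_complP: sM; apply.
have [a'M' c'M'] : a' \in M /\ c' \in M by move: a'M c'M;
  rewrite !in_setD => /andP[_ ->] /andP[].
have sub : Y0 \subset far a b c :|: far a' b c'.
  apply/subsetP => y; rewrite in_set => /and3P[yU]; rewrite inE yU /= => nby lowy.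
  rewrite !in_set yU nby /=; apply: contraT; rewrite negb_or !negb_and !negbK.
  case/andP=> h1 h2; move: lowy; rewrite /low leqNgt; case/negP; apply/card_gt1P.
  have [u uac yu] : exists2 u, u \in [set a; c] & adj y u.
    by case/orP: h1 => h; [exists a | exists c]; rewrite ?inE ?eqxx ?orbT // adj_sym.
  have [v vac yv] : exists2 v, v \in M :\: [set a; c] & adj y v.
    by case/orP: h2 => h; [exists a' | exists c']; rewrite // adj_sym.
  exists u, v; move: vac; rewrite in_setD => /andP[vac vM]; split.
  - by rewrite in_set yu andbT; move: uac; rewrite in_set2 => /orP[]/eqP->.
  - by rewrite in_set yv andbT.
  - by apply: contraNneq vac => <-.
apply: leq_trans (subset_leq_card sub) _; apply: leq_trans (leq_card_setU _ _) _.
rewrite /near_bipartite_bound -/R -/D; apply: leq_trans (leq_addl _ _).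
by rewrite mul2n -addnn leq_add // ltnW // farM.
Qed.
End TriangleFree.

Lemma paw_P3_free_apex_perfect : apex_perfect near_bipartite_bound G.
Proof.
have [|S Sb pS] := @near_bipartite (~: in_triangle).
  move=> a b c aU _ _ ab bc ac; move: aU; rewrite in_setC; case/negP.
  by apply/in_triangleP; exists b, c.
apply/apex_perfectP; exists S => //.
apply: perfect_on_disconnected perfect_on_in_triangle pS.
  move=> x y xT; rewrite !in_set => /andP[_]; apply: contraNN.
  by move/(in_triangle_adj xT); rewrite in_set.
by apply/subsetP => x xS; rewrite in_setU in_setD in_setC -in_setC xS;
  case: (x \in in_triangle).
Qed.
End PawFree.

(** * Excluding the diamond and its complement *)

Section Diamond.
Variable G : sgraph.
Implicit Types K : {set G}.

(** Let K be a maximum clique.  A vertex outside K has at most one neighbour in K,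
    since two neighbours and a non-neighbour in K would complete a diamond.  Two
    non-adjacent vertices outside K would thus have two common non-neighbours in
    K, which gives a co-diamond.  So the complement of K is a clique too. *)
Lemma perfect_on_big_clique : ~~ embeds codiamond G -> ~~ embeds (compl codiamond) G ->
  4 <= omega_on G setT -> perfect_on G setT.
Proof.
move=> ncod ndia om4; have [K [_ cK mK]] := omega_on_ex [set: G].
have cKP := cliqueP _ cK.
have nbr x : x \notin K -> #|[set k in K | adj x k]| <= 1.
  move=> xK; have [k0 k0K xk0] := max_clique_nonadj (subsetT K) cK mK (in_setT x) xK.
  rewrite leqNgt; apply: contra ndia => /card_gt1P[k [l []]].
  rewrite !in_set => /andP[kK xk] /andP[lK xl] kl.
  have nxk m : m \in K -> x != m by move=> mK'; apply: contraNneq xK => ->.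
  have [k0k k0l] : k0 != k /\ k0 != l by split; distinct.
  have [? ? ?] := And3 (nxk _ k0K) (nxk _ kK) (nxk _ lK).
  have [? ? ?] := And3 (cKP _ _ k0K kK k0k) (cKP _ _ k0K lK k0l) (cKP _ _ kK lK kl).
  by apply: (embeds_diamond (a := x) (b := k0) (c := k) (d := l)); pattern_tac.
have cC : clique (~: K).
  apply/cliqueP => x y; rewrite !in_setC => xK yK xy; apply: contraT => nxy.
  case/negP: ncod.
  have /card_gt1P[k [l []]] : 1 < #|[set k in K | ~~ adj x k & ~~ adj y k]|.
    have sub : K \subset ([set k in K | adj x k] :|: [set k in K | adj y k])
        :|: [set k in K | ~~ adj x k & ~~ adj y k].
      apply/subsetP => k kK; rewrite !in_set kK.
      by case: (adj x k) (adj y k) => [] [].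
    have := leq_trans om4 (leq_trans (eq_leq (esym mK)) (subset_leq_card sub)).
    move/leq_trans/(_ (leq_card_setU _ _)) => le4.
    rewrite -(leq_add2l 2); apply: leq_trans le4 _; rewrite leq_add2r.
    by apply: leq_trans (leq_card_setU _ _) _; apply: (leq_add (nbr x xK) (nbr y yK)).
  rewrite !in_set => /and3P[kK xk yk] /and3P[lK xl yl] kl.
  have nK z m : z \notin K -> m \in K -> m != z.
    by move=> zK mK'; apply: contraNneq zK => <-.
  have [? ? ? ?] := And4 (nK x k xK kK) (nK x l xK lK) (nK y k yK kK) (nK y l yK lK).
  have kl' := cKP _ _ kK lK kl.
  by apply: (embeds_codiamond (a := k) (b := l) (c := x) (d := y)); pattern_tac.
apply/perfect_on_compl/(@perfect_on_bipartite (compl G) _ K (~: K)).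
- by rewrite clique_complK.
- by rewrite clique_complK.
- by rewrite setUCr.
Qed.

End Diamond.

Lemma diamond_codiamond_free_apex_perfect (G : sgraph) :
  ~~ embeds codiamond G -> ~~ embeds (compl codiamond) G ->
  apex_perfect (2 ^ (4 + 4)) G.
Proof.
move=> ncod ndia; apply/apex_perfectP.
case: (leqP 4 (omega_on G setT)) => om4.
  by exists set0; rewrite ?cards0 // setC0; apply: perfect_on_big_clique.
case: (leqP 4 (omega_on (compl G) setT)) => al4.
  exists set0; rewrite ?cards0 // setC0; apply/perfect_on_compl.
  by apply: perfect_on_big_clique; rewrite ?embeds_complK // -embeds_complL.
exists setT; last by rewrite setCT; apply: perfect_on_set0.
rewrite leqNgt; apply/negP => /ltnW /ramsey[] [K [_ cK K4]].
  by move: om4; rewrite ltnNge -K4 omega_on_ge ?subsetT.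
by move: al4; rewrite ltnNge -K4 (@omega_on_ge (compl G)) ?subsetT.
Qed.

(** * Excluding C4 and 2K2 *)

Section PseudoSplit.
Variable G : sgraph.
Implicit Types K I : {set G}.
Hypothesis noC4 : ~~ embeds (cycle_graph 4) G.
Hypothesis no2K2 : ~~ embeds (copies (complete 2) 2) G.

Lemma square_free_of_no_C4 : square_free G.
Proof.
move=> a b c d ab bc cd da ac bd nac nbd; case/negP: noC4.
by apply: (embeds_C4 (a := a) (b := b) (c := c) (d := d)); pattern_tac.
Qed.

Lemma two_edge_free_of_no_2K2 : two_edge_free G.
Proof.
move=> a b c d ab cd ac ad bc bd; case/negP: no2K2.
by apply: (embeds_2K2 (a := a) (b := b) (c := c) (d := d)); pattern_tac.
Qed.

Lemma C5_rot (a b c d e : G) : C5 a b c d e -> C5 b c d e a.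
Proof. by case/andP=> /and5P[? ? ? ? ?] /and5P[*]; apply/andP; split; apply/and5P. Qed.

(** Among the maximum cliques choose K with the largest degree sum, and suppose
    that x, y outside K are adjacent.  As there is no C4, one of them, say y, is
    non-adjacent to all vertices of K that x is non-adjacent to; as there is no
    2K2, x has a single non-neighbour z in K.  Then K - z + x is a maximum clique, so deg x <= deg z by
    the choice of K, and z has a neighbour w that is not adjacent to x.  The
    absence of 2K2 gives y ~ w.  If u in K is a non-neighbour of w, the absence of
    C4 shows that y and u are not adjacent, and x, u, z, w, y is a C5. *)
Lemma split_or_C5 :
  (exists K, clique K /\ @clique (compl G) (~: K)) \/
  (exists a b c d e : G, C5 a b c d e).
Proof.
pose deg (x : G) := #|[set y | adj x y]|.
have [K0 [_ cK0 mK0]] := omega_on_ex [set: G].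
pose P (K : {set G}) := clique K && (#|K| == omega_on G setT).
have PK0 : P K0 by rewrite /P cK0 mK0 eqxx.
case: (@arg_maxnP _ K0 P (fun K => \sum_(k in K) deg k) PK0) => K /andP[cK /eqP mK] maxK.
have cKP := cliqueP _ cK.
have nonadj x : x \notin K -> exists2 k, k \in K & ~~ adj x k.
  by apply: max_clique_nonadj cK mK (in_setT x); apply: subsetT.
case: (boolP (@clique (compl G) (~: K))) => [|ncC]; first by left; exists K.
right.
have key x y : x \notin K -> y \notin K -> adj x y ->
    {in K, forall a, ~~ adj x a -> ~~ adj y a} -> exists a b c d e : G, C5 a b c d e.
  move=> xK yK xy sub; have [z zK xz] := nonadj x xK; have yz := sub z zK xz.
  have xadj u : u \in K -> u != z -> adj x u.
    move=> uK uz; apply: contraT => xu; have yu := sub u uK xu.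
    by case: (two_edge_free_of_no_2K2 xy (cKP u z uK zK uz)).
  have [w zw xw] : exists2 w, adj z w & ~~ adj x w.
    apply/exists_inP; apply: contraT => /exists_inPn zx.
    have ltdeg : deg z < deg x.
      apply/proper_card/properP; split.
        by apply/subsetP => w; rewrite !inE => /zx; rewrite negbK.
      by exists y; rewrite inE // adj_sym.
    have PK' : P (x |: K :\ z).
      rewrite /P cardsU1 !inE (negbTE xK) andbF -mK (cardsD1 z K) zK eqxx andbT.
      apply: clique_setU1; first by apply: clique_sub cK; apply: subD1set.
      by move=> u; rewrite !inE => /andP[uz uK]; apply: xadj.
    have := maxK _ PK'; rewrite /= big_setU1 ?inE ?(negbTE xK) ?andbF //=.
    by rewrite (big_setD1 z zK) /= leq_add2r leqNgt ltdeg.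
  have wK : w \notin K.
    apply: contra xw => wK; apply: xadj => //.
    by apply: contraTneq zw => ->; rewrite adj_irr.
  have yw : adj y w.
    by apply: contraT => yw; case: (two_edge_free_of_no_2K2 xy zw).
  have [u uK wu] := nonadj w wK.
  have uz : u != z by apply: contraNneq wu => ->; rewrite adj_sym.
  have yu : ~~ adj y u.
    apply/negP => yu; apply: (@square_free_of_no_C4 w y u z); rewrite // 1?adj_sym //.
    - by rewrite adj_sym cKP.
    - by apply: contraNneq wK => ->.
    - by apply: contraNneq yK => ->.
  exists x, u, z, w, y; rewrite /C5 xadj // (cKP u z) // zw adj_sym yw adj_sym xy.
  by rewrite xz [adj u w]adj_sym wu [adj z y]adj_sym yz [adj w x]adj_sym xw yu.
have [x [y [xK yK xy]]] : exists x y, [/\ x \notin K, y \notin K & adj x y].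
  case: (boolP [exists x in ~: K, exists y in ~: K, adj x y]) => [|nE].
    by case/exists_inP=> x; rewrite inE => xK /exists_inP[y]; rewrite inE; exists x, y.
  case/negP: ncC; apply/clique_complP => x y xK yK; apply/negP => xy.
  by case/exists_inP: nE; exists x => //; apply/exists_inP; exists y.
case: (boolP [forall a in K, ~~ adj x a ==> ~~ adj y a]) => [/forall_inP sub|].
  by apply: (key x y) => // a aK; apply/implyP/sub.
case/forall_inPn => a aK; rewrite negb_imply negbK => /andP[xa ya].
apply: (key y x) => //; first by rewrite adj_sym.
move=> b bK yb; apply/negP => xb.
apply: (@square_free_of_no_C4 x y a b) => //; rewrite 1?adj_sym //.
- by rewrite cKP //; apply: contraNneq yb => ->.
- by apply: contraNneq xK => ->.
- by apply: contraNneq yK => ->.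
Qed.

(** If x ~ a but x is not adjacent to b, the absence of C4 and of 2K2 in turn gives
    that x is not adjacent to c, x ~ d and x ~ e, and then x e and b c are a 2K2.
    Applied to the rotations of the C5, this shows that a vertex outside is
    adjacent to all of its vertices or to none. *)
Lemma C5_nbr (a b c d e x : G) : C5 a b c d e -> x \notin [:: a; b; c; d; e] ->
  adj x a -> adj x b.
Proof.
case/andP=> /and5P[ab bc cd de ea] /and5P[ac bd ce da eb].
rewrite !inE !negb_or => /and5P[na nb nc nd ne] xa; apply: contraT => xb.
have xc : ~~ adj x c.
  apply/negP => xc; apply: (@square_free_of_no_C4 x a b c) => //; first by rewrite adj_sym.
  by distinct.
have xd : adj x d.
  apply: contraT => xd; case: (two_edge_free_of_no_2K2 xa cd) => //; by rewrite adj_sym.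
have xe : adj x e.
  apply: contraT => xe; case: (@square_free_of_no_C4 x d e a) => //;
    first by rewrite adj_sym.
  by distinct.
by case: (two_edge_free_of_no_2K2 xe bc) => //; rewrite adj_sym.
Qed.

(** The vertices complete to the C5 form a clique, as there is no C4, and the
    vertices anticomplete to it form a stable set, as there is no 2K2.  After
    deleting one vertex of the C5, the remaining P4 b - c - d - e splits: c and d
    join the clique, b and e the stable set. *)
Lemma C4_2K2_free_apex_perfect : apex_perfect 1 G.
Proof.
apply/apex_perfectP; case: split_or_C5 => [[K [cK sI]]|[a [b [c [d [e C]]]]]].
  exists set0; first by rewrite cards0.
  by apply: perfect_on_split cK sI _; rewrite setUCr subsetT.
exists [set a]; first by rewrite cards1.
have C1 := C5_rot C; have C2 := C5_rot C1; have C3 := C5_rot C2; have C4 := C5_rot C3.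
pose s := [:: a; b; c; d; e].
have s1 x : x \notin s -> x \notin [:: b; c; d; e; a] by rewrite -(mem_rot 1).
have s2 x : x \notin s -> x \notin [:: c; d; e; a; b] by move/s1; rewrite -(mem_rot 1).
have s3 x : x \notin s -> x \notin [:: d; e; a; b; c] by move/s2; rewrite -(mem_rot 1).
have s4 x : x \notin s -> x \notin [:: e; a; b; c; d] by move/s3; rewrite -(mem_rot 1).
have nbrs x : x \notin s ->
    [/\ adj x b = adj x a, adj x c = adj x a, adj x d = adj x a & adj x e = adj x a].
  move=> xs; have h1 := C5_nbr C xs; have h2 := C5_nbr C1 (s1 x xs).
  have h3 := C5_nbr C2 (s2 x xs); have h4 := C5_nbr C3 (s3 x xs).
  have h5 := C5_nbr C4 (s4 x xs).
  by split; apply/idP/idP; auto.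
have /andP[/and5P[ab bc cd de ea] /and5P[ac bd ce da eb]] := C.
pose K := [set x | (x \notin s) && adj x a]; pose I := [set x | (x \notin s) && ~~ adj x a].
apply: (@perfect_on_split _ _ (c |: (d |: K)) (b |: (e |: I))).
- apply: clique_setU1; first apply: clique_setU1.
  + apply/cliqueP => x y; rewrite !in_set => /andP[xs xa] /andP[ys ya] xy.
    have [_ xc _ _] := nbrs x xs; have [_ yc _ _] := nbrs y ys.
    apply: contraT => nxy; case: (@square_free_of_no_C4 x a y c) => //;
      rewrite ?yc ?[adj c _]adj_sym ?xc //.
      by rewrite adj_sym.
    by distinct.
  + by move=> y; rewrite in_set => /andP[ys ya]; have [_ _ yd _] := nbrs y ys;
    rewrite adj_sym yd.
  + move=> y; rewrite in_setU1 => /predU1P[->//|].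
    by rewrite in_set => /andP[ys ya]; have [_ yc _ _] := nbrs y ys; rewrite adj_sym yc.
- apply: (@clique_setU1 (compl G)); first apply: (@clique_setU1 (compl G)).
  + apply/clique_complP => x y; rewrite !in_set => /andP[xs xa] /andP[ys ya].
    have [xb _ _ _] := nbrs x xs; have [yb _ _ _] := nbrs y ys.
    by apply/negP => xy; case: (two_edge_free_of_no_2K2 xy ab); rewrite ?xb ?yb.
  + move=> y; rewrite in_set => /andP[ys ya]; have [_ _ _ ye] := nbrs y ys.
    rewrite /= /compl_adj [adj e y]adj_sym ye ya andbT.
    by apply: contraNneq ys => <-; rewrite !inE eqxx !orbT.
  + move=> y; rewrite in_setU1 => /predU1P[->|].
      by rewrite /= /compl_adj [adj b e]adj_sym eb andbT; distinct.
    rewrite in_set => /andP[ys ya]; have [yb _ _ _] := nbrs y ys.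
    rewrite /= /compl_adj [adj b y]adj_sym yb ya andbT.
    by apply: contraNneq ys => <-; rewrite !inE eqxx !orbT.
apply/subsetP => x; rewrite in_setC in_set1 => xa.
rewrite /K /I !in_setU !in_set1 !in_set /s !inE (negbTE xa) /=.
case: (x == b) (x == c) (x == d) (x == e) => [] [] [] [] //=.
by case: (adj x a).
Qed.
End PseudoSplit.

(** * Families of graphs that stay imperfect after few deletions *)

Section Blocks.
Variables (m l : nat) (d : rel 'I_l).
Hypothesis d_sym : symmetric d.

Definition blocks_adj : rel ('I_m * 'I_l)%type := fun u v =>
  if u.1 == v.1 then cycle_adj u.2 v.2 else d u.2 v.2.
Lemma blocks_sym : symmetric blocks_adj.
Proof. by move=> u v; rewrite /blocks_adj eq_sym cycle_sym d_sym. Qed.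
Lemma blocks_irr : irreflexive blocks_adj.
Proof. by move=> u; rewrite /blocks_adj eqxx cycle_irr. Qed.
Definition blocks : sgraph := SGraph blocks_sym blocks_irr.

(** Fewer than [m] deletions leave one of the [m] disjoint cycles intact. *)
Lemma blocks_not_apex_perfect c : c < m ->
  ~~ colorable (cycle_graph l) (omega (cycle_graph l)) -> ~ apex_perfect c blocks.
Proof.
move=> cm ncol /apex_perfectP[S Sc pS]; case/negP: ncol.
have [k kS] : exists k, forall i, (k, i) \notin S.
  have : [set u.1 | u in S] != setT.
    apply: contraTneq cm => SE; rewrite -leqNgt -[m]card_ord -cardsT -SE.
    exact: leq_trans (leq_imset_card _ _) Sc.
  rewrite -properT => /properP[_ [k _ kS]]; exists k => i.
  by apply: contra kS => kiS; apply/imsetP; exists (k, i).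
pose f (i : cycle_graph l) : blocks := (k, i).
have fI : injective f by move=> i j [].
have fE i j : adj (f i) (f j) = adj i j by rewrite /= /blocks_adj eqxx.
rewrite (omega_image fI fE); apply: (colorable_image fE); apply: pS.
by apply/subsetP => _ /imsetP[i _ ->]; rewrite in_setC.
Qed.
End Blocks.

(** [cycle_adj] on natural numbers, so that statements about all vertices of a
    short cycle can be checked by computation. *)
Definition cyc (l a b : nat) : bool :=
  (a != b) && ((a.+1 %% l == b) || (b.+1 %% l == a)).

Notation allI l P := (all P (iota 0 l)).

Lemma all_iotaP l (P : pred nat) : allI l P -> forall i : 'I_l, P i.
Proof. by move=> /allP H i; apply: H; rewrite mem_iota /=. Qed.

(** These cycles are triangle-free, and two colours would have to
    alternate along them, which their odd length forbids. *)
Lemma odd_cycle_imperfect l : l \in [:: 5; 7] ->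
  ~~ colorable (cycle_graph l) (omega (cycle_graph l)).
Proof.
move=> l57.
have tri_free : allI l (fun a => allI l (fun b => allI l (fun c =>
    [&& cyc l a b, cyc l b c & cyc l a c] ==> false))).
  by move: l57; rewrite !inE => /orP[]/eqP->; vm_compute.
have om2 : omega (cycle_graph l) <= 2.
  apply/bigmax_leqP => S /cliqueP cS; rewrite leqNgt; apply/card_gt2P.
  case=> [i [j [k [[iS jS kS] [ij jk ki]]]]].
  have := all_iotaP (all_iotaP (all_iotaP tri_free i) j) k.
  rewrite implybF; case/negP; apply/and3P.
  by split; [apply: (cS i j) | apply: (cS j k) | apply: (cS i k)]; rewrite // eq_sym.
apply/negP => /existsP[f /forallP fP].
pose g i := (f i : nat) == 0.
have gP (i j : 'I_l) : cyc l i j -> g i = ~~ g j.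
  move=> ij; have := implyP (forallP (fP i) j) ij.
  rewrite -(inj_eq val_inj) /g /=.
  have := leq_trans (ltn_ord (f i)) om2; have := leq_trans (ltn_ord (f j)) om2.
  by case: (f i : nat) (f j : nat) => [|[|?]] [|[|?]].
move: l57 f fP g gP {tri_free om2}; rewrite !inE => /orP[]/eqP-> f fP g gP.
  have := gP (ordk 5 0) (ordk 5 4) isT.
  rewrite (gP (ordk 5 0) (ordk 5 1) isT) (gP (ordk 5 1) (ordk 5 2) isT).
  by rewrite (gP (ordk 5 2) (ordk 5 3) isT) (gP (ordk 5 3) (ordk 5 4) isT) !negbK;
    case: (g _).
have := gP (ordk 7 0) (ordk 7 6) isT.
rewrite (gP (ordk 7 0) (ordk 7 1) isT) (gP (ordk 7 1) (ordk 7 2) isT).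
rewrite (gP (ordk 7 2) (ordk 7 3) isT) (gP (ordk 7 3) (ordk 7 4) isT).
by rewrite (gP (ordk 7 4) (ordk 7 5) isT) (gP (ordk 7 5) (ordk 7 6) isT) !negbK;
  case: (g _).
Qed.

Section Hereditary.
Variables X G : sgraph.
Hypothesis XG : embeds X G.
Lemma triangle_free_sub : triangle_free G -> triangle_free X.
Proof.
case/embedsP: XG => f fI fE H a b c *.
by apply: (H (f a) (f b) (f c)); rewrite fE.
Qed.
Lemma square_free_sub : square_free G -> square_free X.
Proof.
case/embedsP: XG => f fI fE H a b c d *.
by apply: (H (f a) (f b) (f c) (f d)); rewrite ?fE ?(inj_eq fI).
Qed.
Lemma pentagon_free_sub : pentagon_free G -> pentagon_free X.
Proof.
case/embedsP: XG => f fI fE H a b c d e *.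
by apply: (H (f a) (f b) (f c) (f d) (f e)); rewrite /C5 !fE.
Qed.
Lemma degree_le2_sub : degree_le2 G -> degree_le2 X.
Proof.
case/embedsP: XG => f fI fE H x a b c *.
by apply: (H (f x) (f a) (f b) (f c)); rewrite ?fE ?(inj_eq fI).
Qed.
Lemma two_edge_free_sub : two_edge_free G -> two_edge_free X.
Proof.
case/embedsP: XG => f fI fE H a b c d *.
by apply: (H (f a) (f b) (f c) (f d)); rewrite ?fE.
Qed.
Lemma P4_K1_free_sub : P4_K1_free G -> P4_K1_free X.
Proof.
case/embedsP: XG => f fI fE H a b c d x *.
by apply: (H (f a) (f b) (f c) (f d) (f x)); rewrite ?fE.
Qed.
End Hereditary.

Lemma false_sym l : symmetric (fun _ _ : 'I_l => false). Proof. by []. Qed.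
Definition heptagons m := @blocks m 7 _ (@false_sym 7).
Definition pentagon_blowup m := @blocks m 5 _ (@cycle_sym 5).
Lemma uphalf_sym l : symmetric (fun i j : 'I_l => uphalf i == uphalf j).
Proof. by move=> i j; rewrite eq_sym. Qed.
(** Write s, q', q, p', p for the vertices 0, ..., 4 of each C5.  The half [uphalf]
    of the index puts all s in one clique, all q and q' in a second one, all p and
    p' in a third one; q q' and p p' are edges of the C5 already.  The other edges
    s q', s p and q p' form matchings between the cliques. *)
Definition three_cliques m := @blocks m 5 _ (@uphalf_sym 5).

Section Heptagons.
Variable m : nat.
Implicit Types u v : heptagons m.

Lemma heptagons_adj u v : adj u v -> u.1 = v.1.
Proof. by rewrite /= /blocks_adj; case: eqP. Qed.
Lemma heptagons_adjE u v : u.1 = v.1 -> adj u v = cyc 7 u.2 v.2.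
Proof. by rewrite /= /blocks_adj => ->; rewrite eqxx. Qed.
Lemma heptagons_neq u v : u.1 = v.1 -> (u != v) = (val u.2 != val v.2).
Proof.
case: u v => [k i] [k' j] /= ->; congr negb; rewrite val_eqE.
by apply/eqP/eqP => [[]|->].
Qed.

Lemma heptagons_triangle_free : triangle_free (heptagons m).
Proof.
move=> a b c ab bc ac.
have [eb ec] := (heptagons_adj ab, heptagons_adj ac).
have C : allI 7 (fun x => allI 7 (fun y => allI 7 (fun z =>
  ~~ [&& cyc 7 x y, cyc 7 y z & cyc 7 x z]))) by vm_compute.
have /negP := all_iotaP (all_iotaP (all_iotaP C a.2) b.2) c.2; apply.
by rewrite -!heptagons_adjE ?ab ?bc ?ac -?eb -?ec.
Qed.

Lemma heptagons_square_free : square_free (heptagons m).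
Proof.
move=> a b c d ab bc cd da ac bd nac nbd.
have [eb ec ed] : [/\ a.1 = b.1, a.1 = c.1 & a.1 = d.1].
  have e1 := heptagons_adj ab; have e2 := heptagons_adj bc; have e3 := heptagons_adj cd.
  by split; congruence.
have C : allI 7 (fun x => allI 7 (fun y => allI 7 (fun z => allI 7 (fun t =>
  ~~ [&& cyc 7 x y, cyc 7 y z, cyc 7 z t, cyc 7 t x, x != z & y != t])))).
  by vm_compute.
have /negP := all_iotaP (all_iotaP (all_iotaP (all_iotaP C a.2) b.2) c.2) d.2; apply.
by rewrite -!heptagons_adjE -?eb -?ec -?ed // ab bc cd da /=
  -!heptagons_neq -?eb -?ec -?ed // nac nbd.
Qed.

Lemma heptagons_pentagon_free : pentagon_free (heptagons m).
Proof.
move=> a b c d e /andP[/and5P[ab bc cd de ea] _].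
have [eb ec ed ee] : [/\ a.1 = b.1, a.1 = c.1, a.1 = d.1 & a.1 = e.1].
  have e1 := heptagons_adj ab; have e2 := heptagons_adj bc; have e3 := heptagons_adj cd.
  by have e4 := heptagons_adj de; split; congruence.
have C : allI 7 (fun x => allI 7 (fun y => allI 7 (fun z => allI 7 (fun t =>
  allI 7 (fun s =>
  ~~ [&& cyc 7 x y, cyc 7 y z, cyc 7 z t, cyc 7 t s & cyc 7 s x]))))).
  by vm_compute.
have /negP := all_iotaP (all_iotaP (all_iotaP (all_iotaP (all_iotaP C a.2) b.2) c.2) d.2)
  e.2.
by apply; rewrite -!heptagons_adjE -?eb -?ec -?ed -?ee // ab bc cd de ea.
Qed.

Lemma heptagons_degree_le2 : degree_le2 (heptagons m).
Proof.
move=> x a b c xa xb xc ab bc ac.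
have [ea eb ec] := And3 (heptagons_adj xa) (heptagons_adj xb) (heptagons_adj xc).
have C : allI 7 (fun x => allI 7 (fun y => allI 7 (fun z => allI 7 (fun t =>
  ~~ [&& cyc 7 x y, cyc 7 x z, cyc 7 x t, y != z, z != t & y != t])))).
  by vm_compute.
have /negP := all_iotaP (all_iotaP (all_iotaP (all_iotaP C x.2) a.2) b.2) c.2; apply.
by rewrite -!heptagons_adjE // xa xb xc /= -!heptagons_neq -?ea -?eb -?ec // ab bc ac.
Qed.
End Heptagons.

Section Blowup.
Variable m : nat.
Implicit Types u v : pentagon_blowup m.

Lemma blowup_adjE u v : adj u v = cyc 5 u.2 v.2.
Proof. by rewrite /= /blocks_adj if_same. Qed.

Lemma blowup_triangle_free : triangle_free (pentagon_blowup m).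
Proof.
move=> a b c; rewrite !blowup_adjE => ab bc ac.
have C : allI 5 (fun x => allI 5 (fun y => allI 5 (fun z =>
  ~~ [&& cyc 5 x y, cyc 5 y z & cyc 5 x z]))) by vm_compute.
have /negP := all_iotaP (all_iotaP (all_iotaP C a.2) b.2) c.2; apply.
by rewrite ab bc ac.
Qed.

Lemma blowup_two_edge_free : two_edge_free (pentagon_blowup m).
Proof.
move=> a b c d; rewrite !blowup_adjE => ab cd ac ad bc bd.
have C : allI 5 (fun x => allI 5 (fun y => allI 5 (fun z => allI 5 (fun t =>
  ~~ [&& cyc 5 x y, cyc 5 z t, ~~ cyc 5 x z, ~~ cyc 5 x t, ~~ cyc 5 y z & ~~ cyc 5 y t])))).
  by vm_compute.
have /negP := all_iotaP (all_iotaP (all_iotaP (all_iotaP C a.2) b.2) c.2) d.2; apply.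
by rewrite ab cd ac ad bc bd.
Qed.

Lemma blowup_P4_K1_free : P4_K1_free (pentagon_blowup m).
Proof.
move=> a b c d x; rewrite !blowup_adjE => ab bc cd ac ad bd nx.
have C : allI 5 (fun x => allI 5 (fun y => allI 5 (fun z => allI 5 (fun t =>
  allI 5 (fun s =>
  ~~ ([&& cyc 5 x y, cyc 5 y z, cyc 5 z t, ~~ cyc 5 x z, ~~ cyc 5 x t & ~~ cyc 5 y t] &&
     [&& ~~ cyc 5 s x, ~~ cyc 5 s y, ~~ cyc 5 s z & ~~ cyc 5 s t])))))).
  by vm_compute.
have /negP := all_iotaP (all_iotaP (all_iotaP (all_iotaP (all_iotaP C a.2) b.2) c.2) d.2)
  x.2.
by apply; rewrite ab bc cd ac ad bd nx.
Qed.
End Blowup.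

Section ThreeCliques.
Variable m : nat.
Local Notation Z := (three_cliques m).
Implicit Types u v w : Z.
Definition clique_index (u : Z) : nat := uphalf u.2.

Lemma clique_index_adj u v : clique_index u = clique_index v -> u != v -> adj u v.
Proof.
case: u v => [k i] [k' j]; rewrite /clique_index /= /blocks_adj /= => ij.
case: (eqVneq k k') => [<-|_ _]; last exact/eqP.
rewrite xpair_eqE eqxx /= => nij.
have C : allI 5 (fun x => allI 5 (fun y =>
  (uphalf x == uphalf y) && (x != y) ==> cyc 5 x y)).
  by vm_compute.
by have /implyP := all_iotaP (all_iotaP C i) j; apply; rewrite ij eqxx.
Qed.

Lemma clique_index_nadj u v : adj u v -> clique_index u != clique_index v -> u.1 = v.1.
Proof. by rewrite /= /blocks_adj; case: eqP => // _ /eqP e;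
  rewrite /clique_index e eqxx. Qed.

Lemma three_cliques_adjE u v : u.1 = v.1 -> adj u v = cyc 5 u.2 v.2.
Proof. by rewrite /= /blocks_adj => ->; rewrite eqxx. Qed.

(** A vertex has at most one neighbour in each of the two other cliques. *)
Lemma clique_index_matching u v w : adj u v -> adj u w ->
  clique_index u != clique_index v -> clique_index v = clique_index w -> v = w.
Proof.
move=> uv uw nuv evw; have nuw : clique_index u != clique_index w by rewrite -evw.
have [ev ew] := (clique_index_nadj uv nuv, clique_index_nadj uw nuw).
move: uv uw; rewrite !three_cliques_adjE // => uv uw.
have C : allI 5 (fun x => allI 5 (fun y => allI 5 (fun z =>
  [&& cyc 5 x y, cyc 5 x z, uphalf x != uphalf y & uphalf y == uphalf z] ==> (y == z)))).
  by vm_compute.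
have /implyP := all_iotaP (all_iotaP (all_iotaP C u.2) v.2) w.2.
rewrite uv uw -/(clique_index u) -/(clique_index v) -/(clique_index w) nuv evw eqxx =>
  /(_ isT)/eqP/val_inj e2.
by move: ev ew e2 {evw uv uw nuv nuw}; case: v w => [? ?] [? ?] /= <- <- ->.
Qed.

(** By the matching property a triangle lies in one clique or meets all three; in
    the second case it would lie in a single C5. *)
Lemma clique_index_triangle u v w : adj u v -> adj v w -> adj u w ->
  clique_index u = clique_index v.
Proof.
move=> uv vw uw; apply/eqP; apply: contraT => nuv.
have nvw : clique_index v != clique_index w.
  apply/eqP => evw; have e := clique_index_matching uv uw nuv evw.
  by rewrite e adj_irr in vw.
have nuw : clique_index u != clique_index w.
  apply/eqP => euw; have e := @clique_index_matching v u w; rewrite adj_sym in uv.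
  by move: uw; rewrite e // ?adj_irr // eq_sym.
have [ev ew] := (clique_index_nadj uv nuv, clique_index_nadj uw nuw).
move: uv uw vw; rewrite !three_cliques_adjE -?ev // => uv uw vw.
have C : allI 5 (fun x => allI 5 (fun y => allI 5 (fun z =>
  ~~ [&& cyc 5 x y, cyc 5 x z & cyc 5 y z]))) by vm_compute.
have /negP := all_iotaP (all_iotaP (all_iotaP C u.2) v.2) w.2; case.
by rewrite uv uw vw.
Qed.

(** The two triangles of a diamond share an edge, so they would lie in the same
    clique. *)
Lemma three_cliques_diamond_free : ~~ embeds (compl codiamond) Z.
Proof.
apply/negP => /embedsP[f fI fE].
pose a := f (inl (ordk 2 0)); pose b := f (inl (ordk 2 1)).
pose c := f (inr (ordk 2 0, ordk 1 0)); pose d := f (inr (ordk 2 1, ordk 1 0)).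
have ac : adj a c by rewrite fE. have ad : adj a d by rewrite fE.
have bc : adj b c by rewrite fE. have bd : adj b d by rewrite fE.
have cd : adj c d by rewrite fE.
have ab : a != b by rewrite (inj_eq fI).
have : adj a b by rewrite clique_index_adj // (clique_index_triangle ac cd ad)
  (clique_index_triangle bc cd bd).
by rewrite fE.
Qed.

Lemma three_cliques_stable : omega_on (compl Z) setT <= 3.
Proof.
have [K [_ /clique_complP sK <-]] := @omega_on_ex (compl Z) setT.
pose g (u : Z) : 'I_3 := inord (clique_index u).
have gE u : g u = clique_index u :> nat.
  rewrite inordK // /clique_index.
  by have C : allI 5 (fun x => uphalf x < 3) by []; apply: (all_iotaP C).
rewrite -[3]card_ord -(card_in_imset (f := g)) ?max_card // => u v uK vK.
move/(congr1 val); rewrite /= !gE => e; apply/eqP; apply: contraT => nuv.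
by have := sK u v uK vK; rewrite clique_index_adj.
Qed.
End ThreeCliques.

(** * Graphs without short cycles and without three independent vertices *)

Notation alpha X := (omega_on (compl X) setT).

Lemma omega_on_embeds (X G : sgraph) : embeds X G -> omega_on X setT <= omega_on G setT.
Proof.
case/embedsP => f fI fE; have [K [_ /cliqueP cK <-]] := omega_on_ex [set: X].
rewrite -(card_imset K fI); apply: omega_on_ge => //.
apply/cliqueP => _ _ /imsetP[x xK ->] /imsetP[y yK ->].
by rewrite (inj_eq fI) fE; apply: cK.
Qed.

Lemma alpha_embeds (X G : sgraph) : embeds X G -> alpha X <= alpha G.
Proof. by move/embeds_compl/omega_on_embeds. Qed.

Lemma triangle_free_omega (G : sgraph) : triangle_free G -> omega_on G setT <= 2.
Proof.
move=> tf; have [K [_ /cliqueP cK <-]] := omega_on_ex [set: G].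
rewrite leqNgt; apply/card_gt2P => -[a [b [c [[aK bK cK'] [ab bc ca]]]]].
by apply: (tf a b c); apply: cK => //; rewrite eq_sym.
Qed.

Lemma alpha_le2 (X : sgraph) (a b c : X) : alpha X <= 2 ->
  a != b -> b != c -> a != c -> [|| adj a b, adj b c | adj a c].
Proof.
move=> al ab bc ac; apply: contraLR al; rewrite !negb_or => /and3P[nab nbc nac].
rewrite -ltnNge.
have <- : #|[set a; b; c]| = 3 by rewrite -setUA cardsU1 cards2 !inE negb_or ab ac bc.
apply: omega_on_ge => //; apply/clique_complP => x y; rewrite !inE.
by move=> /orP[/orP[]|]/eqP-> /orP[/orP[]|]/eqP->; rewrite ?adj_irr // 1?adj_sym.
Qed.

Definition ord4 := [:: ordk 4 0; ordk 4 1; ordk 4 2; ordk 4 3].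
(** The truncation to [n] vertices lets the same test recognize all induced
    subgraphs of P4. *)
Definition codes_P4 (b : seq bool) n :=
  has (fun t => adj_code (@adj (path_graph 4)) t == b) [seq take n t | t <- permutations
    ord4].
Definition codes_2K2 (b : seq bool) :=
  has (fun t => adj_code (@adj (copies (complete 2) 2)) t == b)
   (permutations [:: (ordk 2 0, ordk 2 0); (ordk 2 0, ordk 2 1); (ordk 2 1, ordk 2 0);
     (ordk 2 1, ordk 2 1)]).

Lemma codes_P4_embeds (X : sgraph) (s : seq X) n : uniq s -> (forall x, x \in s) ->
  size s = n -> n <= 4 -> codes_P4 (adj_code (@adj X) s) n -> embeds (X) (path_graph 4).
Proof.
move=> us sP sz n4 /hasP[_ /mapP[t tP ->] /eqP e].
have pt : perm_eq t ord4 by rewrite -mem_permutations.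
apply: (embeds_seq us sP) (esym e).
  by rewrite take_uniq // (perm_uniq pt).
by rewrite sz size_takel // (perm_size pt).
Qed.

Lemma codes_2K2_iso (X : sgraph) (s : seq X) : uniq s -> (forall x, x \in s) ->
  size s = 4 -> codes_2K2 (adj_code (@adj X) s) -> iso X (copies (complete 2) 2).
Proof.
move=> us sP sz /hasP[t]; rewrite mem_permutations => pt /eqP e.
have XE : embeds X (copies (complete 2) 2).
  apply: (embeds_seq us sP) (esym e); first by rewrite (perm_uniq pt).
  by rewrite sz (perm_size pt).
apply: embeds_card_iso => //; rewrite card_prod !card_ord.
by rewrite -[2 * 2]sz -(card_uniqP us) max_card.
Qed.

Section NoSmallCycle.
Variable X : sgraph.
Hypotheses (tf : triangle_free X) (sf : square_free X) (pf : pentagon_free X).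
Hypothesis al : alpha X <= 2.

Let tfb (a b c : X) : ~~ [&& adj a b, adj b c & adj a c].
Proof. by apply/negP => /and3P[ab bc]; apply: tf ab bc. Qed.
Let sfb (a b c d : X) : a != c -> b != d ->
  ~~ [&& adj a b, adj b c, adj c d, adj d a, ~~ adj a c & ~~ adj b d].
Proof. by move=> ac bd; apply/negP => /and5P[ab bc cd da /andP[? ?]];
  apply: (@sf a b c d). Qed.
Let pfb (a b c d e : X) : ~~ C5 a b c d e.
Proof. by apply/negP/pf. Qed.

(** A graph on five vertices without triangle and without stable set of size 3 is
    a C5; this is checked over all ten adjacencies.  The twelve instances of [C5]
    are the twelve cyclic orders of five vertices. *)
Lemma card_le4_of_alpha_le2 : #|X| <= 4.
Proof.
rewrite leqNgt; apply/card_geqP => -[s [us sz _]]; move: us sz.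
case: s => [|a [|b [|c [|d [|e [|? ?]]]]]] //=.
rewrite !inE !negb_or !andbT.
case/and4P=> /and4P[ab ac ad ae] /and3P[bc bd be] /andP[cd ce] de _.
have := tfb a b c; have := tfb a b d; have := tfb a b e; have := tfb a c d.
have := tfb a c e; have := tfb a d e; have := tfb b c d; have := tfb b c e.
have := tfb b d e; have := tfb c d e.
have := alpha_le2 al ab bc ac; have := alpha_le2 al ab bd ad.
have := alpha_le2 al ab be ae; have := alpha_le2 al ac cd ad.
have := alpha_le2 al ac ce ae; have := alpha_le2 al ad de ae.
have := alpha_le2 al bc cd bd; have := alpha_le2 al bc ce be.
have := alpha_le2 al bd de be; have := alpha_le2 al cd de ce.
have := pfb a b d e c; have := pfb a b e d c; have := pfb a b c e d.
have := pfb a b e c d; have := pfb a b c d e; have := pfb a b d c e.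
have := pfb a c b e d; have := pfb a c e b d; have := pfb a c b d e.
have := pfb a c d b e; have := pfb a d b c e; have := pfb a d c b e.
rewrite /C5 ?[adj b a]adj_sym ?[adj c a]adj_sym ?[adj d a]adj_sym ?[adj e a]adj_sym
  ?[adj c b]adj_sym ?[adj d b]adj_sym ?[adj e b]adj_sym
  ?[adj d c]adj_sym ?[adj e c]adj_sym ?[adj e d]adj_sym.
move: (adj a b) (adj a c) (adj a d) (adj a e) (adj b c) (adj b d) (adj b e)
  (adj c d) (adj c e) (adj d e).
by do 10![case].
Qed.

Lemma P4_or_2K2_of_alpha_le2 : embeds X (path_graph 4) \/ iso X (copies (complete 2) 2).
Proof.
have [s us sP] : exists2 s : seq X, uniq s & forall x, x \in s.
  by exists (enum X) => [|x]; rewrite ?enum_uniq // mem_enum.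
have sz : size s <= 4.
  by rewrite -(card_uniqP us); apply: leq_trans (max_card _) card_le4_of_alpha_le2.
have P4 := codes_P4_embeds us sP erefl sz; have K2 := codes_2K2_iso us sP.
case: s us {sP} sz P4 K2 => [|a [|b [|c [|d []]]]] //= us _ P4 K2.
- by left; apply: P4.
- by left; apply: P4.
- by left; apply: P4; case: (adj a b).
- left; apply: P4; move: us; rewrite !inE negb_or andbT => /andP[/andP[ab ac] bc].
  have := tfb a b c; have := alpha_le2 al ab bc ac.
  by case: (adj a b) (adj a c) (adj b c) => [] [] []; vm_compute.
move: us; rewrite !inE !negb_or !andbT => /and3P[/and3P[ab ac ad] /andP[bc bd] cd].
suff : codes_P4 [:: adj a b; adj a c; adj a d; adj b c; adj b d; adj c d] 4 ||
       codes_2K2 [:: adj a b; adj a c; adj a d; adj b c; adj b d; adj c d].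
  by case/orP=> ?; [left; apply: P4 | right; apply: K2].
have := tfb a b c; have := tfb a b d; have := tfb a c d; have := tfb b c d.
have := alpha_le2 al ab bc ac; have := alpha_le2 al ab bd ad.
have := alpha_le2 al ac cd ad; have := alpha_le2 al bc cd bd.
have := @sfb a b c d ac bd; have := @sfb a b d c ad bc; have := @sfb a c b d ab cd.
rewrite ?[adj b a]adj_sym ?[adj c a]adj_sym ?[adj d a]adj_sym
  ?[adj c b]adj_sym ?[adj d b]adj_sym ?[adj d c]adj_sym.
move: (adj a b) (adj a c) (adj a d) (adj b c) (adj b d) (adj c d) {P4 K2}.
by do 6![case]; vm_compute.
Qed.
End NoSmallCycle.

(** * Induced subgraphs common to heptagons and pentagon blow-ups *)

Section Short.
Variable X : sgraph.
Implicit Types p : seq X.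

(** [p] lists, in order, the vertices of an induced path with at most three
    vertices that contains all edges of [X]; thus [X] is P_k + rK1 for some k <= 3. *)
Definition short_path p := [/\ uniq p, size p <= 3,
  {in p &, forall x y, adj x y =
     ((index x p).+1 == index y p) || ((index y p).+1 == index x p)}
  & forall x y : X, adj x y -> x \in p].

Lemma short_path_embeds p (H : sgraph) (g : X -> H) : short_path p ->
  {in [predC p] &, injective g} -> is_edgeless H ->
  embeds X (disjoint_union (path_graph 3) H).
Proof.
move=> [up sz pP supp] gI eH; apply/embedsP.
pose f x : disjoint_union (path_graph 3) H :=
  if x \in p then inl (inord (index x p)) else inr (g x).
have lt x : x \in p -> index x p < 3 by rewrite -index_mem => /leq_trans; apply.
exists f => [x y|x y]; rewrite /f; case: (boolP (x \in p)) => xp;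
  case: (boolP (y \in p)) => yp //.
- case=> /(congr1 val); rewrite /= !inordK ?lt // => e.
  by rewrite -(nth_index x xp) e nth_index.
- by case=> /gI; apply.
- by rewrite /= /path_adj !inordK ?lt // pP.
- by rewrite /=; apply/esym/negbTE; apply: contraNN yp; rewrite adj_sym => /supp.
- by rewrite /=; apply/esym/negbTE; apply: contraNN xp => /supp.
- by rewrite /= (negbTE (eH _ _)); apply/esym/negbTE; apply: contraNN xp => /supp.
Qed.

Lemma edgeless_copies1 r : is_edgeless (copies (complete 1) r).
Proof. by case=> i a [j b];
  rewrite /= /copies_adj /= (ord1 a) (ord1 b) /complete_adj eqxx andbF. Qed.

Lemma edgeless_complete1 : is_edgeless (complete 1).
Proof. by move=> a b; rewrite (ord1 a) (ord1 b) adj_irr. Qed.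

Lemma short_path_P3_rK1 p : short_path p ->
  embeds X (disjoint_union (path_graph 3) (copies (complete 1) #|X|)).
Proof.
move=> sp; apply: (@short_path_embeds p (copies (complete 1) #|X|) (fun x =>
  (enum_rank x, ord0 : 'I_1)) sp).
  by move=> x y _ _ [] /enum_rank_inj.
exact: edgeless_copies1.
Qed.

Lemma short_path_P3_K1 p : short_path p -> #|[predC p]| <= 1 ->
  embeds X (disjoint_union (path_graph 3) (complete 1)).
Proof.
move=> sp /card_le1_eqP p1.
apply: (@short_path_embeds p (complete 1) (fun=> ord0) sp _) edgeless_complete1.
by move=> x y xp yp _; apply/esym/p1.
Qed.

Lemma alpha_ge (S : {set X}) : {in S &, forall x y, ~~ adj x y} -> #|S| <= alpha X.
Proof. by move=> /clique_complP sS; apply: omega_on_ge. Qed.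

End Short.

Section Classification.
Variable X : sgraph.
Hypotheses (tf : triangle_free X) (sf : square_free X) (pf : pentagon_free X).
Hypotheses (d2 : degree_le2 X) (k2 : two_edge_free X) (p4 : P4_K1_free X).

(** Another vertex cannot be adjacent to b or c, which have two neighbours already.
    It would thus create a C5, a 2K2 or a P4 + K1. *)
Lemma P4_whole (a b c d : X) : adj a b -> adj b c -> adj c d ->
  ~~ adj a c -> ~~ adj a d -> ~~ adj b d -> embeds X (path_graph 4).
Proof.
move=> ab bc cd nac nad nbd.
have ac : a != c by distinct.
have ad : a != d by distinct.
have bd : b != d by distinct.
have us : uniq [:: a; b; c; d] by uniq_tac.
have all_in x : x \in [:: a; b; c; d].
  apply: contraT; rewrite !inE !negb_or => /and4P[xa xb xc xd].
  have ba : adj b a by rewrite adj_sym.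
  have cb : adj c b by rewrite adj_sym.
  have nxb : ~~ adj x b.
    by apply/negP; rewrite adj_sym => bx; apply: (d2 ba bc bx); rewrite // eq_sym.
  have nxc : ~~ adj x c.
    by apply/negP; rewrite adj_sym => cx; apply: (d2 cb cd cx); rewrite // eq_sym.
  case: (boolP (adj x a)) (boolP (adj x d)) => xa' [] xd'.
  + case: (pf (a := x) (b := a) (c := b) (d := c) (e := d)).
    by rewrite /C5 xa' ab bc cd adj_sym xd' nxb nac nbd [adj c x]adj_sym nxc adj_sym nad.
  + by case: (k2 xa' cd).
  + by case: (k2 xd' ab); rewrite // adj_sym.
  + by case: (p4 ab bc cd nac nad nbd (x := x)); rewrite xa' nxb nxc.
apply: (embeds_seq us all_in (t := (ord4 : seq (path_graph 4))) isT erefl).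
by rewrite /= ab (negbTE nac) (negbTE nad) bc (negbTE nbd) cd.
Qed.

(** Either all vertices have degree at most 1 and, as there is no 2K2, there is at
    most one edge; or some vertex b has two neighbours a and c, and then any edge
    off the path a - b - c yields an induced P4 by the absence of 2K2. *)
Lemma P4_or_short_path : embeds X (path_graph 4) \/ exists p : seq X, short_path p.
Proof.
case: (boolP [exists b : X, exists a, exists c, [&& a != c, adj b a & adj b c]]).
  case/existsP=> b /existsP[a /existsP[c /and3P[ac ba bc]]].
  have nac : ~~ adj a c by apply/negP => h; apply: tf ba h bc.
  have ab : adj a b by rewrite adj_sym.
  have [ab' bc'] : a != b /\ b != c by split; distinct.
  case: (boolP [forall x, forall y, adj x y ==> (x \in [:: a; b; c])]) => [supp|].
    right; exists [:: a; b; c]; split=> //.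
    - by rewrite /= !inE negb_or ab' ac bc'.
    - have [? ? ?] : [/\ (b == a) = false, (c == a) = false & (c == b) = false].
        by split; apply/negbTE; rewrite eq_sym.
      move=> x y; rewrite !inE => /or3P[]/eqP-> /or3P[]/eqP->;
      rewrite /= ?eqxx ?(negbTE ab') ?(negbTE ac) ?(negbTE bc') ?(eq_sym b a) ?(eq_sym c
        a) ?(eq_sym c b) ?eqxx ?(negbTE ab') ?(negbTE ac) ?(negbTE bc') /= ?adj_irr //;
      by first [exact: negbTE | rewrite adj_sym; first [done | exact: negbTE]].
    by move=> x y; move/forallP/(_ x)/forallP/(_ y)/implyP: supp.
  case/forallPn=> x /forallPn[y]; rewrite negb_imply !inE !negb_or.
  case/andP=> xy /and3P[xa xb xc]; left.
  have nbx : ~~ adj b x.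
    by apply/negP => bx; apply: (d2 ba bc bx); rewrite // eq_sym.
  (* An edge z u with z not adjacent to b extends u - b - v to an induced P4, as
     z ~ v would close a C4. *)
  have ext u v z : adj b u -> adj b v -> u != v -> ~~ adj u v -> z != b ->
      ~~ adj b z -> adj z u -> embeds X (path_graph 4).
    move=> bu bv uv nuv zb nbz zu.
    have nzv : ~~ adj z v.
      apply/negP => zv; apply: (@sf z u b v) => //; rewrite 1?adj_sym //.
    by apply: (@P4_whole z u b v) => //; rewrite 1?adj_sym.
  have ext2 z : z != b -> ~~ adj b z -> adj z a || adj z c -> embeds X (path_graph 4).
    move=> zb nbz /orP[za|zc]; first exact: (ext a c z).
    by apply: (ext c a z); rewrite // 1?eq_sym // adj_sym.
  case: (boolP (adj x a || adj x c)) => [h|]; first exact: ext2 h.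
  rewrite negb_or => /andP[nxa nxc].
  have ya : y != a by apply: contraNneq nxa => <-.
  have yc : y != c by apply: contraNneq nxc => <-.
  have yb : y != b by apply: contraNneq nbx => <-; rewrite adj_sym.
  have nby : ~~ adj b y.
    by apply/negP => h; apply: (d2 ba bc h); rewrite // eq_sym.
  apply: (ext2 y) => //; apply: contraT; rewrite negb_or => /andP[nya nyc].
  by case: (k2 xy ab); rewrite // adj_sym.
move=> /existsPn nodeg2; right.
have uni (b a c : X) : adj b a -> adj b c -> a = c.
  move=> ba bc; apply/eqP; apply: contraT => ac.
  by move: (nodeg2 b) => /existsPn/(_ a)/existsPn/(_ c); rewrite ac ba bc.
case: (boolP [exists a : X, exists b, adj a b]) => [|/existsPn noedge].
  case/existsP=> a /existsP[b ab]; have ba : adj b a by rewrite adj_sym.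
  have nab : a != b by distinct.
  exists [:: a; b]; split=> //.
  - by rewrite /= !inE nab.
  - move=> x y; rewrite !inE => /orP[]/eqP-> /orP[]/eqP->;
    by rewrite /= ?eqxx ?(negbTE nab) ?(eq_sym b a) ?eqxx ?(negbTE nab) /= ?adj_irr.
  move=> x y xy; rewrite !inE; apply: contraT; rewrite negb_or => /andP[xa xb].
  have yx : adj y x by rewrite adj_sym.
  case: (k2 xy ab); apply/negP.
  - by rewrite adj_sym => h; rewrite (uni a x b h ab) eqxx in xb.
  - by rewrite adj_sym => h; rewrite (uni b x a h ba) eqxx in xa.
  - move=> h; have h' := uni y a x h yx; by rewrite h' eqxx in xa.
  - move=> h; have h' := uni y b x h yx; by rewrite h' eqxx in xb.
exists [::]; split=> // x y xy.
by have /existsPn/(_ y) := noedge x; rewrite xy.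
Qed.
End Classification.

Section AtLeastThree.
Variables (X : sgraph) (p : seq X).
Hypothesis sp : short_path p.

Lemma short_path_edge : is_edgeless X \/
  exists a b s, [/\ p = a :: b :: s, adj a b & {in s, forall z, ~~ adj a z}].
Proof.
case: sp => up sz pP supp; case: p up sz pP supp => [|a [|b s]] up sz pP supp.
- by left=> x y; apply/negP => /supp.
- left=> x y; apply/negP => xy; have yx : adj y x by rewrite adj_sym.
  have /eqP ya : y == a by have := supp _ _ yx; rewrite inE.
  have /eqP xa : x == a by have := supp _ _ xy; rewrite inE.
  by rewrite xa ya adj_irr in xy.
right; exists a, b, s.
have /= /and3P[na nb us] := up.
have ab : a != b by apply: contraNneq na => ->; rewrite inE eqxx.
split=> //.
  by rewrite pP ?inE ?eqxx ?orbT //= eqxx (negbTE ab) eqxx.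
move=> z zs; rewrite pP ?inE ?eqxx ?zs ?orbT //= eqxx.
case: (eqVneq a z) => [az|az]; first by rewrite az inE zs orbT in na.
case: (eqVneq b z) => [bz|bz]; first by rewrite bz zs in nb.
by [].
Qed.

(** The vertices off the path are isolated, so they can be added to any stable set
    on the path. *)
Lemma stable_outside (S : {set X}) : {in S &, forall x y, ~~ adj x y} ->
  S \subset p -> #|S| + #|[predC p]| <= alpha X.
Proof.
case: sp => _ _ _ supp sS Sp; pose T := [set x | x \notin p].
have -> : #|[predC p]| = #|T| by apply: eq_card => x; rewrite !inE.
have <- : #|S :|: T| = #|S| + #|T|.
  rewrite cardsU disjoint_setI0 ?cards0 ?subn0 //.
  by rewrite disjoint_subset; apply/subsetP => x /(subsetP Sp); rewrite !inE negbK.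
have nT x y : x \in T -> ~~ adj x y by rewrite inE; apply: contraNN => /supp.
apply: alpha_ge => x y; rewrite !in_setU => /orP[xS|xT]; last by rewrite nT.
by case/orP=> [|yT]; [apply: sS | rewrite adj_sym nT].
Qed.

Lemma short_path_codiamond a b s : p = a :: b :: s -> adj a b ->
  1 < #|[predC p]| -> embeds codiamond X.
Proof.
case: sp => _ _ _ supp pE ab /card_gt1P[u [v []]]; rewrite !inE => up vp uv.
have nad x y : x \notin p -> ~~ adj x y by apply: contraNN => /supp.
have [ua ub va vb] : [/\ u != a, u != b, v != a & v != b].
  by move: up vp; rewrite pE !inE !negb_or => /and3P[? ? _] /and3P[? ? _].
have [? ? ? ?] := And4 (nad u a up) (nad u b up) (nad v a vp) (nad v b vp).
have ? := nad u v up.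
by apply: (embeds_codiamond (a := a) (b := b) (c := u) (d := v)); pattern_tac.
Qed.

(** With at most one vertex off the path, or with three vertices and no edge, the
    graph embeds in P3 + K1.  If it has an edge and at least two vertices off the
    path, there is a stable set of size 4, unless there are exactly two such
    vertices and the path is a single edge: this is K2 + 2K1. *)
Lemma alpha3_cases : 3 <= alpha X ->
  embeds X (disjoint_union (path_graph 3) (complete 1)) \/ 4 <= alpha X \/
  (embeds X codiamond /\ embeds codiamond X).
Proof.
move=> al3; case: (leqP 4 (alpha X)) => al4; first by right; left.
case: (leqP #|[predC p]| 1) => p1; first by left; apply: short_path_P3_K1 sp p1.
case: short_path_edge => [eX|[a [b [s [pE ab nas]]]]].
  left; rewrite -embeds_complK.
  have sK : @clique (compl (disjoint_union (path_graph 3) (complete 1)))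
     [set inl (ordk 3 0); inl (ordk 3 2); inr (ordk 1 0)].
    apply/clique_complP => x y; rewrite !inE.
    by move=> /orP[/orP[]|]/eqP-> /orP[/orP[]|]/eqP->.
  apply: (embeds_complete _ sK).
    by move=> x y xy; rewrite /= /compl_adj xy eX.
  have -> : #|[set inl (ordk 3 0); inl (ordk 3 2); inr (ordk 1 0)]
      : {set disjoint_union (path_graph 3) (complete 1)}| = 3.
    by rewrite -setUA cardsU1 cards2 !inE.
  have := @alpha_ge X setT (fun x y _ _ => eX x y); rewrite cardsT => le.
  by apply: leq_trans le _; rewrite -ltnS.
right; right; have cX := short_path_codiamond pE ab p1; split=> //.
apply/iso_embeds/iso_sym/embeds_card_iso => //.
have -> : #|codiamond| = 4 by rewrite card_sum card_prod !card_ord.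
have [up _ _ _] := sp.
have cp : #|X| = size p + #|[predC p]|.
  by rewrite -(cardC (mem p)) (card_uniqP up).
have al3' : alpha X <= 3 by rewrite -ltnS.
have := sp; rewrite cp; case=> _; rewrite pE; case: s pE nas => [|z [|//]] pE nas _ _ _ /=.
  have := @stable_outside [set a]; rewrite pE cards1 => H.
  rewrite (@leq_add2l 2 _ 2) -(leq_add2l 1) (leq_trans (H _ _)) //.
    by move=> x y; rewrite !inE => /eqP-> /eqP->; rewrite adj_irr.
  by apply/subsetP => x; rewrite !inE => /eqP->; rewrite eqxx.
have naz : ~~ adj a z by apply: nas; rewrite inE.
have := @stable_outside [set a; z]; rewrite pE cards2 => H.
have az : a != z by move: up; rewrite pE /= !inE negb_or; case: (a == z); rewrite ?andbF.
suff : 4 <= alpha X by rewrite leqNgt ltnS al3'.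
rewrite -[4]/(2 + 2); rewrite az in H; apply: leq_trans (H _ _); rewrite -?pE ?leq_add2l //.
  by move=> x y; rewrite !inE => /orP[]/eqP-> /orP[]/eqP->; rewrite ?adj_irr // adj_sym.
by apply/subsetP => x; rewrite pE !inE => /orP[]/eqP->; rewrite eqxx ?orbT.
Qed.

(** At most two vertices of a stable set lie on the path, so two of the isolated
    vertices remain, to be combined with an edge of the path. *)
Lemma alpha4_codiamond : 4 <= alpha X -> ~ is_edgeless X -> embeds codiamond X.
Proof.
move=> al4 nE; case: short_path_edge => [//|[a [b [s [pE ab nas]]]]].
apply: (short_path_codiamond pE ab).
have [I [_ /clique_complP sI cI]] := @omega_on_ex (compl X) setT.
have [up sz _ _] := sp.
have sub : [set x in I | x \in p] \subset [set x in behead p] \/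
           [set x in I | x \in p] \subset [set x in a :: s].
  case: (boolP (a \in I)) => aI; [right|left]; apply/subsetP => x; rewrite pE !inE.
    case/andP=> xI /or3P[->//|/eqP xb|->]; last by rewrite orbT.
    by have := sI a x aI xI; rewrite xb ab.
  by case/andP=> xI /orP[/eqP xa|//]; rewrite -xa xI in aI.
have le2 : #|[set x in I | x \in p]| <= 2.
  have card_seq (t : seq X) : #|[set x in t]| <= size t.
    by rewrite cardsE card_size.
  have sz2 : size s <= 1 by move: sz; rewrite pE.
  case: sub => /subset_leq_card /leq_trans; apply; apply: leq_trans (card_seq _) _.
    by rewrite pE.
  by rewrite /=.
have : #|I| <= #|[set x in I | x \in p]| + #|[predC p]|.
  rewrite -(cardsID [set x | x \in p] I) leq_add //.
    by apply/subset_leq_card/subsetP => x; rewrite !inE.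
  by apply/subset_leq_card/subsetP => x; rewrite !inE => /andP[].
rewrite cI => /(leq_trans al4) le; rewrite -(leq_add2l 2).
by apply: leq_trans le _; rewrite leq_add2r.
Qed.
End AtLeastThree.

(** * The classification *)

Definition apex_bound (H1 H2 : sgraph) c :=
  apex_perfect_class c (free (pair_set H1 H2)).

Lemma free_pairP H1 H2 G :
  free (pair_set H1 H2) G <-> ~~ embeds H1 G /\ ~~ embeds H2 G.
Proof.
split=> [fG|[n1 n2] H [] ->]; last 2 first.
- by move/induced_subgraphP; apply/negP.
- by move/induced_subgraphP; apply/negP.
by split; apply/negP => /induced_subgraphP; apply: fG; [left | right].
Qed.

Lemma apex_boundP H1 H2 c : apex_bound H1 H2 c <->
  forall G, ~~ embeds H1 G -> ~~ embeds H2 G -> apex_perfect c G.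
Proof.
split=> H G; last by case/free_pairP; apply: H.
by move=> n1 n2; apply: H; apply/free_pairP.
Qed.

Lemma apex_bound_switch H1 H2 c : apex_bound H1 H2 c -> apex_bound H2 H1 c.
Proof. by move/apex_boundP => H; apply/apex_boundP => G n2 n1; apply: H. Qed.

Lemma apex_bound_compl H1 H2 c :
  apex_bound (compl H1) (compl H2) c <-> apex_bound H1 H2 c.
Proof.
split=> /apex_boundP H; apply/apex_boundP => G n1 n2; apply/apex_perfectP.
  have [||S Sc /perfect_on_compl pS] := (apex_perfectP _ _).1 (H (compl G) _ _);
  by rewrite ?embeds_complK //; exists S.
rewrite !embeds_complL in n1 n2.
have [S Sc /perfect_on_compl pS] := (apex_perfectP _ _).1 (H (compl G) n1 n2).
by exists S.
Qed.

Lemma apex_bound_embeds H1 H2 K1 K2 c : embeds H1 K1 -> embeds H2 K2 ->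
  apex_bound K1 K2 c -> apex_bound H1 H2 c.
Proof.
move=> e1 e2 /apex_boundP H; apply/apex_boundP => G n1 n2; apply: H.
  by apply: contra n1; apply: embeds_trans.
by apply: contra n2; apply: embeds_trans.
Qed.

Lemma up_to_switch_compl_bound (P : sgraph -> sgraph -> Prop) (Q : nat -> Prop) H1 H2 :
  (forall A B, P A B -> exists2 c, Q c & apex_bound A B c) ->
  up_to_switch_compl P H1 H2 -> exists2 c, Q c & apex_bound H1 H2 c.
Proof.
move=> PQ [] /PQ[c Qc b]; exists c => //.
- exact: apex_bound_switch.
- exact/apex_bound_compl.
- exact/apex_bound_compl/apex_bound_switch.
Qed.

Definition square_pair (A B : sgraph) : Prop :=
  iso A (cycle_graph 4) /\ iso B (copies (complete 2) 2).

Definition good_pair (A B : sgraph) : Prop :=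
  induced_subgraph A (path_graph 4) \/
  (induced_subgraph A paw /\
   exists r : nat, induced_subgraph B
     (disjoint_union (path_graph 3) (copies (complete 1) r))) \/
  (is_complete A /\ is_edgeless B) \/
  (induced_subgraph A (compl codiamond) /\ induced_subgraph B codiamond) \/
  square_pair A B.

Lemma square_pair_bound A B : square_pair A B -> apex_bound A B 1.
Proof.
case=> /iso_embeds eA /iso_embeds eB; apply: apex_bound_embeds eA eB _.
by apply/apex_boundP => G; apply: C4_2K2_free_apex_perfect.
Qed.

Lemma good_pair_bound A B : good_pair A B -> exists c, apex_bound A B c.
Proof.
case=> [/induced_subgraphP eA|[|[|[|sq]]]].
- exists 0; apply/apex_boundP => G nA _; apply/apex_perfectP.
  exists set0; rewrite ?cards0 //; apply: perfect_on_P4_free => a b c d _ t.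
  case/negP: nA; apply: embeds_trans eA _; apply: (embeds_P4 _ t).
  case: t => ab ac ad bc bd cd.
  have uniqP : forall x y z : G, adj x z = ~~ adj y z -> x != y.
    by move=> x y z; apply: contra_eqN => /eqP->; case: (adj y z).
  have nab : a != b by apply: contraTneq isT => e; rewrite e adj_irr in ab.
  have nbc : b != c by apply: contraTneq isT => e; rewrite e adj_irr in bc.
  have ncd : c != d by apply: contraTneq isT => e; rewrite e adj_irr in cd.
  have nac : a != c by apply: (uniqP _ _ d); rewrite ad cd.
  have nbd : b != d by apply: (uniqP _ _ a); rewrite [adj d a]adj_sym ad adj_sym ab.
  have nad : a != d by apply: (uniqP _ _ b); rewrite ab adj_sym bd.
  by rewrite /= !inE !negb_or nab nac nad nbc nbd ncd.
- case=> /induced_subgraphP eA [r /induced_subgraphP eB].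
  exists (near_bipartite_bound r); apply: apex_bound_embeds eA eB _.
  by apply/apex_boundP => G; apply: paw_P3_free_apex_perfect.
- case=> cA eB; exists (2 ^ (#|A| + #|B|)); apply/apex_boundP => G nA nB.
  apply/apex_perfectP; exists setT; last by rewrite setCT; apply: perfect_on_set0.
  rewrite leqNgt; apply/negP => /ltnW /ramsey[] [K [_ cK szK]].
    by case/negP: nA; apply: (embeds_complete cA cK); rewrite szK.
  case/negP: nB; rewrite -embeds_complK.
  apply: (embeds_complete _ cK); last by rewrite szK.
  by move=> x y xy; rewrite /= /compl_adj xy eB.
- case=> /induced_subgraphP eA /induced_subgraphP eB.
  exists (2 ^ (4 + 4)); apply: apex_bound_embeds eA eB _.
  by apply/apex_boundP => G n1 n2; apply: diamond_codiamond_free_apex_perfect.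
by exists 1; apply: square_pair_bound.
Qed.

Section Necessity.
Variables (H1 H2 : sgraph) (c : nat).
Hypothesis bound12 : apex_bound H1 H2 c.

Lemma embeds_unbounded G : ~ apex_perfect c G -> embeds H1 G \/ embeds H2 G.
Proof.
move=> nG; case: (boolP (embeds H1 G)) => e1; first by left.
case: (boolP (embeds H2 G)) => e2; first by right.
by case: nG; apply: (apex_boundP _ _ _).1 bound12 _ e1 e2.
Qed.
End Necessity.

Lemma square_compl : iso (compl (copies (complete 2) 2)) (cycle_graph 4).
Proof.
apply/iso_sym/embeds_card_iso; last by rewrite card_prod !card_ord.
by apply: (@embeds_C4 (compl (copies (complete 2) 2))
  (ordk 2 0, ordk 2 0) (ordk 2 1, ordk 2 0) (ordk 2 0, ordk 2 1) (ordk 2 1, ordk 2 1)).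
Qed.

Lemma iso_compl H G : iso H G -> iso (compl H) (compl G).
Proof.
case=> f fB fE; exists f => //= x y.
by rewrite /compl_adj fE (inj_eq (bij_inj fB)).
Qed.

Lemma iso_trans G H K : iso G H -> iso H K -> iso G K.
Proof.
case=> f fB fE [g gB gE]; exists (g \o f); first exact: bij_comp.
by move=> x y; rewrite /= gE fE.
Qed.

Lemma not_square_free_square : ~ square_free (cycle_graph 4).
Proof. by move/(_ (ordk 4 0) (ordk 4 1) (ordk 4 2) (ordk 4 3)); apply. Qed.

(** If the complement of [X] embeds, then [X] has no three independent vertices and
    is not 2K2, whose complement is C4. *)
Lemma heptagons_self_compl_P4 m X : embeds X (heptagons m) ->
  embeds (compl X) (heptagons m) -> embeds X (path_graph 4).
Proof.
move=> eX eC.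
have al : alpha X <= 2.
  exact: leq_trans (omega_on_embeds eC) (triangle_free_omega (@heptagons_triangle_free m)).
case: (P4_or_2K2_of_alpha_le2 (triangle_free_sub eX (@heptagons_triangle_free m))
  (square_free_sub eX (@heptagons_square_free m))
  (pentagon_free_sub eX (@heptagons_pentagon_free m)) al) => // iX.
have e4 := iso_embeds (iso_sym (iso_trans (iso_compl iX) square_compl)).
case: not_square_free_square; apply: square_free_sub (embeds_trans e4 eC) _.
exact: heptagons_square_free.
Qed.

Lemma heptagons_alpha m X : embeds X (heptagons m) -> ~~ embeds X (path_graph 4) ->
  3 <= alpha X \/ iso X (copies (complete 2) 2).
Proof.
move=> eX nP; case: (leqP 3 (alpha X)) => al; first by left.
case: (P4_or_2K2_of_alpha_le2 (triangle_free_sub eX (@heptagons_triangle_free m))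
  (square_free_sub eX (@heptagons_square_free m))
  (pentagon_free_sub eX (@heptagons_pentagon_free m)) al) => e; last by right.
by rewrite e in nP.
Qed.

Lemma blowup_short_path m X : embeds X (heptagons m) -> embeds X (pentagon_blowup m) ->
  ~~ embeds X (path_graph 4) -> exists p : seq X, short_path p.
Proof.
move=> eF eQ nP.
case: (P4_or_short_path (triangle_free_sub eF (@heptagons_triangle_free m))
  (square_free_sub eF (@heptagons_square_free m))
  (pentagon_free_sub eF (@heptagons_pentagon_free m))
  (degree_le2_sub eF (@heptagons_degree_le2 m))
  (two_edge_free_sub eQ (@blowup_two_edge_free m))
  (P4_K1_free_sub eQ (@blowup_P4_K1_free m))) => // e.
by rewrite e in nP.
Qed.

Lemma not_two_edge_free_2K2 : ~ two_edge_free (copies (complete 2) 2).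
Proof.
by move/(_ (ordk 2 0, ordk 2 0) (ordk 2 0, ordk 2 1) (ordk 2 1, ordk 2 0) (ordk 2 1,
  ordk 2 1)); apply.
Qed.

Lemma edgelessP X : is_edgeless X \/ ~ is_edgeless X.
Proof.
case: (boolP [forall x : X, forall y, ~~ adj x y]) => h; [left|right].
  by move=> x y; move/forallP/(_ x)/forallP/(_ y): h.
by move=> e; case/negP: h; apply/forallP => x; apply/forallP => y; apply: e.
Qed.

Lemma edgeless_compl_complete X : is_edgeless (compl X) -> is_complete X.
Proof.
by move=> e x y xy; have := e x y; rewrite /= /compl_adj xy negbK.
Qed.

Lemma embeds_complKr H G : embeds H (compl (compl G)) = embeds H G.
Proof. by rewrite -embeds_complL embeds_complK. Qed.

Lemma iso_complK G : iso G (compl (compl G)).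
Proof. by exists id; [exists id | move=> x y; apply: adj_complK]. Qed.

Lemma P4_compl : embeds (compl (path_graph 4)) (path_graph 4).
Proof.
rewrite embeds_complL.
by apply: (@embeds_P4 (compl (path_graph 4)) (ordk 4 1) (ordk 4 3) (ordk 4 0) (ordk 4 2)).
Qed.

Lemma embeds_compl_P4 X : embeds (compl X) (path_graph 4) -> embeds X (path_graph 4).
Proof. by rewrite embeds_complL => e; apply: embeds_trans e P4_compl. Qed.

Section Exclusion.
Variables (H1 H2 : sgraph) (c : nat).
Hypothesis bound12 : apex_bound H1 H2 c.

(** The blow-up is triangle-free, so it cannot contain [H1]. *)
Lemma stable3_embeds_blowup : 3 <= alpha (compl H1) -> embeds H2 (pentagon_blowup c.+1).
Proof.
rewrite omega_on_complK => al.
have [e|//] := embeds_unbounded bound12 (@blocks_not_apex_perfect c.+1 5 _ (@cycle_sym 5) c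
   (ltnSn c) (@odd_cycle_imperfect 5 isT)).
have := leq_trans al (leq_trans (omega_on_embeds e) (triangle_free_omega
  (@blowup_triangle_free c.+1))).
by [].
Qed.

(** Otherwise [H1] would contain a diamond and [H2] a 4K1, and neither would embed
    in the three joined cliques. *)
Lemma no_codiamond_stable4 : embeds codiamond (compl H1) -> 4 <= alpha H2 -> False.
Proof.
rewrite -embeds_complL => eC al.
have [e|e] := embeds_unbounded bound12 (@blocks_not_apex_perfect c.+1 5 _ (@uphalf_sym 5) c
   (ltnSn c) (@odd_cycle_imperfect 5 isT)).
  by have := @three_cliques_diamond_free c.+1; rewrite (embeds_trans eC e).
by have := leq_trans al (leq_trans (alpha_embeds e) (three_cliques_stable c.+1)).
Qed.
End Exclusion.

Lemma iso_2K2_blowup m X : iso X (copies (complete 2) 2) ->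
  ~ embeds X (pentagon_blowup m).
Proof.
move=> /iso_sym/iso_embeds e eQ; apply: not_two_edge_free_2K2.
exact: two_edge_free_sub (embeds_trans e eQ) (@blowup_two_edge_free m).
Qed.

(** The complement of [H1] and [H2] play symmetric roles, the symmetry being
    complementation followed by exchange.  If one of them has three independent
    vertices, the other embeds in the blow-up of C5 and so is not 2K2; hence both
    are 2K2 or neither is.  In the second case both embed in the blow-up and are
    of the form P_k + rK1 with k <= 3, and the third family decides which
    combinations survive. *)
Lemma good_pair_of_linear H1 H2 c : apex_bound H1 H2 c ->
  embeds (compl H1) (heptagons c.+1) -> embeds H2 (heptagons c.+1) ->
  ~~ embeds H1 (path_graph 4) -> ~~ embeds H2 (path_graph 4) ->
  good_pair H1 H2 \/ good_pair (compl H2) (compl H1).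
Proof.
move=> bound12 e1 e2 n1 n2.
have n1' : ~~ embeds (compl H1) (path_graph 4) by apply: contra n1; apply: embeds_compl_P4.
have bound21 : apex_bound (compl H2) (compl H1) c by
  apply/apex_bound_switch/apex_bound_compl.
have blow2 := stable3_embeds_blowup bound12.
have blow1 : 3 <= alpha H2 -> embeds (compl H1) (pentagon_blowup c.+1).
  by rewrite -[omega_on _ _]omega_on_complK; apply: stable3_embeds_blowup bound21.
have [al1|i1] := heptagons_alpha e1 n1'; have [al2|i2] := heptagons_alpha e2 n2;
  last 3 first.
- by case: (iso_2K2_blowup i2 (blow2 al1)).
- by case: (iso_2K2_blowup i1 (blow1 al2)).
- left; do 4!right; split=> //; apply: iso_trans (iso_complK H1) _.
  exact: iso_trans (iso_compl i1) square_compl.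
have [p1 sp1] := blowup_short_path e1 (blow1 al2) n1'.
have [p2 sp2] := blowup_short_path e2 (blow2 al1) n2.
have no1 := no_codiamond_stable4 bound12.
have no2 : embeds codiamond H2 -> 4 <= alpha (compl H1) -> False.
  by rewrite -embeds_complKr; apply: no_codiamond_stable4 bound21.
case: (alpha3_cases sp1 al1) => [f1|f1].
  left; right; left; split; first by apply/induced_subgraphP; rewrite -embeds_complL.
  by exists #|H2|; apply/induced_subgraphP/(short_path_P3_rK1 sp2).
case: (alpha3_cases sp2 al2) => [f2|f2].
  right; right; left; split; first by apply/induced_subgraphP; rewrite embeds_complK.
  by exists #|compl H1|; apply/induced_subgraphP/(short_path_P3_rK1 sp1).
case: f1 f2 => [f1|[c1 c1']] [f2|[c2 c2']].
- have [eg1|eg1] := edgelessP (compl H1); last first.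
    by case: (no1 (alpha4_codiamond sp1 f1 eg1) f2).
  have [eg2|eg2] := edgelessP H2; last first.
    by case: (no2 (alpha4_codiamond sp2 f2 eg2) f1).
  by left; do 2!right; left; split=> //; apply: edgeless_compl_complete.
- by case: (no2 c2' f1).
- by case: (no1 c1' f2).
left; do 3!right; left; split; apply/induced_subgraphP => //.
by rewrite -embeds_complL.
Qed.

Lemma good_pair_necessary H1 H2 c : apex_bound H1 H2 c ->
  up_to_switch_compl good_pair H1 H2.
Proof.
move=> bound12.
case: (boolP (embeds H1 (path_graph 4))) => [e|n1].
  by apply: Or41; left; apply/induced_subgraphP.
case: (boolP (embeds H2 (path_graph 4))) => [e|n2].
  by apply: Or42; left; apply/induced_subgraphP.
have nF := @blocks_not_apex_perfect c.+1 7 _ (@false_sym 7) c (ltnSn c)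
  (@odd_cycle_imperfect 7 isT).
have bound21 := (apex_bound_compl _ _ _).2 bound12.
have [e1|e2] := embeds_unbounded bound12 nF; have [f1|f2] := embeds_unbounded bound21 nF.
- by rewrite (heptagons_self_compl_P4 e1 f1) in n1.
- case: (good_pair_of_linear (apex_bound_switch bound12) f2 e1 n2 n1) => g.
    exact: Or42.
  exact: Or43.
- case: (good_pair_of_linear bound12 f1 e2 n1 n2) => g.
    exact: Or41.
  exact: Or44.
- by rewrite (heptagons_self_compl_P4 e2 f2) in n2.
Qed.

Theorem theorem1p5 (H1 H2 : sgraph) :
  ((exists c : nat, apex_perfect_class c (free (pair_set H1 H2))) <->
   up_to_switch_compl (fun A B : sgraph =>
     induced_subgraph A (path_graph 4) \/
     (induced_subgraph A
        (compl (disjoint_union (path_graph 3) (complete 1))) /\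
      exists r : nat, induced_subgraph B
        (disjoint_union (path_graph 3) (copies (complete 1) r))) \/
     (is_complete A /\ is_edgeless B) \/
     (induced_subgraph A
        (compl (disjoint_union (complete 2) (copies (complete 1) 2))) /\
      induced_subgraph B
        (disjoint_union (complete 2) (copies (complete 1) 2))) \/
     (iso A (cycle_graph 4) /\ iso B (copies (complete 2) 2))) H1 H2) /\
  (up_to_switch_compl (fun A B : sgraph =>
     iso A (cycle_graph 4) /\ iso B (copies (complete 2) 2)) H1 H2 ->
   apex_perfect_class 1 (free (pair_set H1 H2))).
Proof.
split; first split.
- by case=> c; apply: good_pair_necessary.
- move=> g; have [|c _ b] := @up_to_switch_compl_bound good_pair (fun=> True) H1 H2 _ g.
    by move=> A B /good_pair_bound[c b]; exists c.
  by exists c.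
move=> g; have [|c ->] := @up_to_switch_compl_bound square_pair (fun c => c = 1) H1 H2 _ g.
  by move=> A B /square_pair_bound b; exists 1.
by [].
Qed.
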